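(* Let $G$ be a graph with $n$ vertices, edge set $E$ and set of missing edges (non-adjacent pairs of vertices) $E^C$, and for a fixed value of $k$ let $$B_G=\begin{bmatrix}0&\partial_{k-1}^G&0\\ \partial_{k-1}^{G\dagger}&0&\partial_k^G\\ 0&\partial_k^{G\dagger}&0\end{bmatrix},$$ where the blocks indicate the subspaces $\mathcal{H}_{k-1}^G$, $\mathcal{H}_k^G$ and $\mathcal{H}_{k+1}^G$. The Toffoli complexity of block encoding $B_G/\lambda$ is $$6|E|+2\log k+5n+11\log n+\mathcal{O}(1)$$ when given a database of edges $E$, or $$4|E^C|+5n+11\log n+\mathcal{O}(1)$$ when given a database of missing edges $E^C$. The value of $\lambda$ for this block encoding is approximately $n$.
   Context: $\log$ denotes the logarithm to base 2. The $n$ vertices of $G$ are represented by $n$ qubits, and a computational basis state $|x\rangle$, $x\in\{0,1\}^n$, represents the set of vertices where $x$ has a one. $\mathcal{H}_j^G$ is the span of those $|x\rangle$ for which $x$ represents a $j$-clique of $G$. The boundary map $\partial_j^G:\mathcal{H}_{j+1}^G\to\mathcal{H}_j^G$ is $\partial_j^G|x\rangle=\sum_{i=0}^{j}(-1)^i|x\backslash(i)\rangle$, where $x\backslash(i)$ is $x$ with its $i$-th one (counting from $0$) set to $0$. $B_G$ gives zero on the rest of $(\mathbb{C}^2)^{\otimes n}$. Let $P$ be the projector onto $\mathcal{H}_{k-1}^G\oplus\mathcal{H}_k^G\oplus\mathcal{H}_{k+1}^G$, which tests the Hamming weight and the cliques. The block encoding is given by a unitary $V$ on an ancilla system together with the $n$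 qubits satisfying $(|0\rangle\langle 0|\otimes P)V(|0\rangle\langle 0|\otimes P)=|0\rangle\langle 0|\otimes B_G/\lambda$, and the tests expressed by $P$ are applied as part of the reflection $R=i(2|0\rangle\langle 0|\otimes P-I)$ in the walk operator $W=RV$; the stated complexity counts both $V$ and the tests in this reflection. ''Database'' means a classical list of the edges (or missing edges). Complexity is measured by the number of Toffoli gates; Clifford gates and measurements are not counted. *)

(* Defs.v *)
From HB Require Import structures.
From mathcomp Require Import all_boot all_order all_algebra.
From mathcomp Require Import reals exp.

Set Implicit Arguments.
Unset Strict Implicit.
Unset Printing Implicit Defensive.

Import Order.TTheory GRing.Theory Num.Theory.
Local Open Scope ring_scope.
Local Open Scope sesquilinear_scope.

Definition log2 (R : realType) (x : R) : R := ln x / ln 2.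

(* The qubits form an arbitrary finite type Q, so that the disjoint union of
   two registers is the sum type; the Hilbert space of Q is 'cV[C]_(dim Q). *)
Definition basis (Q : finType) := {ffun Q -> bool}.

Notation dim Q := #|{: basis Q}|.

Definition ket (C : numClosedFieldType) (Q : finType) (x : basis Q)
  : 'cV[C]_(dim Q) := delta_mx (enum_rank x) 0.

(* The linear map sending |x> to f x for every computational basis state x. *)
Definition linmap (C : numClosedFieldType) (Q Q' : finType)
    (f : basis Q -> 'cV[C]_(dim Q')) : 'M[C]_(dim Q', dim Q) :=
  \matrix_(i, j) f (enum_val j) i 0.

Definition lpart (Q Q' : finType) (x : basis (Q + Q')%type) : basis Q :=
  [ffun q => x (inl q)].

Definition rpart (Q Q' : finType) (x : basis (Q + Q')%type) : basis Q' :=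
  [ffun q => x (inr q)].

Definition tensor (C : numClosedFieldType) (Q Q' : finType)
    (A : 'M[C]_(dim Q)) (B : 'M[C]_(dim Q')) : 'M[C]_(dim (Q + Q')%type) :=
  \matrix_(i, j)
    (A (enum_rank (lpart (enum_val i))) (enum_rank (lpart (enum_val j)))
     * B (enum_rank (rpart (enum_val i))) (enum_rank (rpart (enum_val j)))).

Definition zero_state (Q : finType) : basis Q := [ffun=> false].

Definition proj0 (C : numClosedFieldType) (Q : finType) : 'M[C]_(dim Q) :=
  ket C (zero_state Q) *m (ket C (zero_state Q))^t*.

(* H, S and CNOT generate the Clifford group (up to global phases). *)
Inductive gate (Q : finType) : Type :=
| Hadamard (q : Q)
| Phase (q : Q)
| CNOT (a t : Q) of a != t
| Toffoli (a b t : Q) of uniq [:: a; b; t].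

(* [Measure q c0 c1] measures q in the computational basis and continues with
   c0 or c1 according to the outcome, so that later gates may depend on all
   earlier outcomes. *)
Inductive circuit (Q : finType) : Type :=
| Stop
| Apply (g : gate Q) (c : circuit Q)
| Measure (q : Q) (c0 c1 : circuit Q).

Arguments Stop {Q}.

Definition set_bit (Q : finType) (x : basis Q) (q : Q) (b : bool) : basis Q :=
  [ffun r => if r == q then b else x r].

Definition gate_mx (C : numClosedFieldType) (Q : finType) (g : gate Q)
  : 'M[C]_(dim Q) :=
  linmap (fun x =>
    match g with
    | Hadamard q =>
        (sqrtC 2)^-1 *: (ket C (set_bit x q false)
                         + (-1) ^+ x q *: ket C (set_bit x q true))
    | Phase q => 'i ^+ x q *: ket C x
    | CNOT a t _ => ket C (set_bit x t (x t (+) x a))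
    | Toffoli a b t _ => ket C (set_bit x t (x t (+) (x a && x b)))
    end).

Definition outcome_mx (C : numClosedFieldType) (Q : finType) (q : Q) (b : bool)
  : 'M[C]_(dim Q) :=
  linmap (fun x => if x q == b then ket C x else 0).

(* One Kraus operator for each sequence of measurement outcomes. *)
Fixpoint kraus (C : numClosedFieldType) (Q : finType) (c : circuit Q)
  : seq 'M[C]_(dim Q) :=
  match c with
  | Stop => [:: 1%:M]
  | Apply g c' => [seq K *m gate_mx C g | K <- kraus C c']
  | Measure q c0 c1 =>
      [seq K *m outcome_mx C q false | K <- kraus C c0]
      ++ [seq K *m outcome_mx C q true | K <- kraus C c1]
  end.

(* The worst case over the measurement outcomes. *)
Fixpoint toffoli_count (Q : finType) (c : circuit Q) : nat :=
  match c with
  | Stop => 0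
  | Apply g c' =>
      (if g is Toffoli _ _ _ _ then 1 else 0) + toffoli_count c'
  | Measure _ c0 c1 => maxn (toffoli_count c0) (toffoli_count c1)
  end%N.

(* |x> |-> |x>|0>, appending a work register initialised to zero. *)
Definition append0 (C : numClosedFieldType) (Q : finType) (w : nat)
  : 'M[C]_(dim (Q + 'I_w)%type, dim Q) :=
  linmap (fun x : basis Q =>
    ket C ([ffun r => if r is inl q then x q else false]
           : basis (Q + 'I_w)%type)).

(* Whatever the outcomes, c applies U to Q and returns the work qubits to zero.
   The scalar z is the amplitude of the outcomes times a physically irrelevant
   global phase; as the Kraus operators of c satisfy sum K^dagger K = 1, the
   |z|^2 of all the outcomes sum to 1 when U is unitary. *)
Definition implements (C : numClosedFieldType) (Q : finType) (w : nat)
    (c : circuit (Q + 'I_w)%type) (U : 'M[C]_(dim Q)) : Prop :=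
  forall K, K \in kraus C c ->
    exists z : C, K *m append0 C Q w = z *: (append0 C Q w *m U).

Definition edges (n : nat) (e : rel 'I_n) : {set {set 'I_n}} :=
  [set [set u; v] | u in 'I_n, v in e u].

Definition missing_edges (n : nat) (e : rel 'I_n) : {set {set 'I_n}} :=
  edges (fun u v => (u != v) && ~~ e u v).

(* A database of A lists every element of A once, in any order. *)
Definition is_database (T : finType) (A : {set T}) (s : seq T) : Prop :=
  perm_eq s (enum A).

Definition vertices (n : nat) (x : basis 'I_n) : {set 'I_n} := [set v | x v].

Definition is_clique (n : nat) (e : rel 'I_n) (j : nat) (x : basis 'I_n)
  : bool :=
  (#|vertices x| == j)
  && [forall u in vertices x, forall v in vertices x, (u != v) ==> e u v].

(* v is the i-th one of x when x has exactly i ones before v. *)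
Definition delete_one (n : nat) (x : basis 'I_n) (i : nat) : basis 'I_n :=
  [ffun v : 'I_n => x v && (#|[set u : 'I_n | x u && (u < v)%N]| != i)].

(* Extended by zero on the orthogonal complement of H_(j+1). *)
Definition boundary (C : numClosedFieldType) (n : nat) (e : rel 'I_n) (j : nat)
  : 'M[C]_(dim 'I_n) :=
  linmap (fun x =>
    if is_clique e j.+1 x
    then \sum_(i < j.+1) (-1) ^+ i *: ket C (delete_one x i) else 0).

(* For 0 < k, the block matrix on H_(k-1), H_k, H_(k+1), each block being
   extended by zero to the whole space of n qubits. *)
Definition dirac (C : numClosedFieldType) (n : nat) (e : rel 'I_n) (k : nat)
  : 'M[C]_(dim 'I_n) :=
  boundary C e k.-1 + (boundary C e k.-1)^t*
  + boundary C e k + (boundary C e k)^t*.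

Definition clique_proj (C : numClosedFieldType) (n : nat) (e : rel 'I_n)
    (k : nat) : 'M[C]_(dim 'I_n) :=
  linmap (fun x =>
    if [|| is_clique e k.-1 x, is_clique e k x | is_clique e k.+1 x]
    then ket C x else 0).

(* The circuits for V and for the reflection R, which act on the same qubits;
   each has its own number of work qubits besides. *)
Record encoding (n : nat) := Encoding {
  ancillas : nat;
  workV : nat;
  workR : nat;
  circV : circuit ('I_ancillas + 'I_n + 'I_workV)%type;
  circR : circuit ('I_ancillas + 'I_n + 'I_workR)%type
}.

Definition cost (n : nat) (d : encoding n) : nat :=
  (toffoli_count (circV d) + toffoli_count (circR d))%N.

Definition flagged (C : numClosedFieldType) (a n : nat) (A : 'M[C]_(dim 'I_n))
  : 'M[C]_(dim ('I_a + 'I_n)%type) :=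
  tensor (proj0 C 'I_a) A.

Definition reflection (C : numClosedFieldType) (a n : nat) (e : rel 'I_n)
    (k : nat) : 'M[C]_(dim ('I_a + 'I_n)%type) :=
  'i *: (2 *: flagged a (clique_proj C e k) - 1%:M).

Definition block_encodes (C : numClosedFieldType) (n : nat) (e : rel 'I_n)
    (k : nat) (lam : C) (d : encoding n) : Prop :=
  let P := flagged (ancillas d) (clique_proj C e k) in
  exists V : 'M[C]_(dim ('I_(ancillas d) + 'I_n)%type),
    [/\ V \is unitarymx,
        P *m V *m P = flagged (ancillas d) (lam^-1 *: dirac C e k),
        implements (circV d) V &
        implements (circR d) (reflection C (ancillas d) e k)].

(* Main.v *)
(* On all of (C^2)^n let D = sum_v Z_(<v) X_v.  Restricted to cliques of sizes
   k - 1, k, k + 1 this is B_G, so it is enough to block encode D and to let P do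
   the rest.  D is a linear combination of n unitaries, encoded as W^* SEL W: W
   prepares the uniform superposition of an index register, and one round of
   amplitude amplification concentrates it on the good states (v, y) with v < n and
   y < t; SEL computes the indicators delta_v of the index in unary, about one AND
   per v, after which the controlled Z_(<v) X_v are Clifford gates.  All good
   states get the same amplitude, whence lambda = n / (alpha (3 - 4 alpha)^2) with
   alpha close to 1/4, and lambda is close to n.

   For R it is enough to recognise cliques.  If A is the set of edges (of missing
   edges), x is a j-clique iff it has weight j and contains 'C(j,2) (zero) pairs of
   A; population counts cost at most one AND per bit, so this takes
   n + 2|A| + O(log n) ANDs.

   Every reversible computation is undone after use, at 2 Toffoli gates per AND,
   and no measurement is needed: the total is 4|A| + 4n + O(log n), and O(log n)
   is at most n + O(1). *)
Require Import Defs.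
From HB Require Import structures.
From mathcomp Require Import all_boot all_order all_algebra.
From mathcomp Require Import reals exp complex boolp.
From mathcomp Require Import zify ring lra.

Set Implicit Arguments.
Unset Strict Implicit.
Unset Printing Implicit Defensive.

Import Order.TTheory GRing.Theory Num.Theory.
Local Notation dim Q := #|{: basis Q}|.

(** * Straight-line programs over F_2, measured by their AND gates *)

Section StraightLine.
Variables (Q : finType) (I : pred Q).
Implicit Types (f g b r : basis Q -> bool) (gs hs bs F : seq (basis Q -> bool)).

(* A circuit of CNOT, NOT and Toffoli gates is modelled by the list gs of the
   products it has computed.  CNOT and NOT give for free the affine combinations
   over F_2 of the input qubits in I and of gs (xspan); each Toffoli appends the
   product of two of them (ext). *)
Definition nthf gs i : basis Q -> bool := nth (fun=> false) gs i.

Inductive xspan gs : (basis Q -> bool) -> Prop :=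
| xspan_input q of I q : xspan gs (fun x => x q)
| xspan_gate i : xspan gs (nthf gs i)
| xspan_true : xspan gs (fun=> true)
| xspan_xor f g of xspan gs f & xspan gs g : xspan gs (fun x => f x (+) g x)
| xspan_ext f g of f =1 g & xspan gs f : xspan gs g.

Inductive ext gs : seq (basis Q -> bool) -> Prop :=
| ext_refl : ext gs gs
| ext_and hs f g of ext gs hs & xspan hs f & xspan hs g :
    ext gs (rcons hs (fun x => f x && g x)).

Definition reach c gs hs := ext gs hs /\ size hs <= size gs + c.

(** No bound on [i] is imposed: past the end [nthf] gives the constant false, which lies in every
    span. *)
Definition xspans gs F := forall i, xspan gs (nthf F i).

Lemma xspan_false gs : xspan gs (fun=> false).
Proof. by apply: xspan_ext (xspan_xor (xspan_true gs) (xspan_true gs)). Qed.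

Lemma xspan_neg gs f : xspan gs f -> xspan gs (fun x => ~~ f x).
Proof. by move=> sf; apply: xspan_ext (xspan_xor (xspan_true gs) sf). Qed.

Lemma xspan_constx gs f (c : bool) : xspan gs f -> xspan gs (fun x => f x (+) c).
Proof.
case: c => sf; first by apply: xspan_ext (xspan_neg sf) => x; rewrite addbT.
by apply: xspan_ext sf => x; rewrite addbF.
Qed.

Lemma ext_prefix gs hs : ext gs hs -> exists ts, hs = gs ++ ts.
Proof.
elim=> [|hs' f g _ [ts ->] _ _]; first by exists [::]; rewrite cats0.
by exists (rcons ts (fun x => f x && g x)); rewrite rcons_cat.
Qed.

(** Products are only appended, so an index below [size gs] keeps its meaning; an index past the end
    stood for the constant false, which is true + true in any span. *)
Lemma xspan_mono gs hs f : ext gs hs -> xspan gs f -> xspan hs f.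
Proof.
move=> /ext_prefix [ts ->]; elim=> {f} [q Iq|i||f g _ sf _ sg|f g fg _ sf].
- exact: xspan_input.
- have [lt_i|le_i] := ltnP i (size gs).
    have -> : nthf gs i = nthf (gs ++ ts) i by rewrite /nthf nth_cat lt_i.
    exact: xspan_gate.
  by rewrite /nthf nth_default //; apply: xspan_false.
- exact: xspan_true.
- exact: xspan_xor.
- exact: xspan_ext fg sf.
Qed.

Lemma ext_trans gs hs ks : ext gs hs -> ext hs ks -> ext gs ks.
Proof. by move=> gh; elim=> // *; apply: ext_and. Qed.

Lemma reach0 gs : reach 0 gs gs.
Proof. by split; [exact: ext_refl | rewrite addn0]. Qed.

Lemma reach_trans c1 c2 gs hs ks :
  reach c1 gs hs -> reach c2 hs ks -> reach (c1 + c2) gs ks.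
Proof.
move=> [e1 s1] [e2 s2]; split; first exact: ext_trans e1 e2.
by rewrite addnA (leq_trans s2) // leq_add2r.
Qed.

Lemma reach_le c1 c2 gs hs : c1 <= c2 -> reach c1 gs hs -> reach c2 gs hs.
Proof. by move=> le12 [e s]; split=> //; rewrite (leq_trans s) ?leq_add2l. Qed.

Lemma xspan_reach c gs hs f : reach c gs hs -> xspan gs f -> xspan hs f.
Proof. by move=> [e _]; apply: xspan_mono. Qed.

Lemma xspans_reach c gs hs F : reach c gs hs -> xspans gs F -> xspans hs F.
Proof. by move=> gh sF i; apply: xspan_reach gh _. Qed.

Lemma reach_and gs f g : xspan gs f -> xspan gs g ->
  exists2 hs, reach 1 gs hs & xspan hs (fun x => f x && g x).
Proof.
move=> sf sg; exists (rcons gs (fun x => f x && g x)).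
  by split; [apply: ext_and sf sg; exact: ext_refl | rewrite size_rcons addn1].
have := xspan_gate (rcons gs (fun x => f x && g x)) (size gs).
by rewrite /nthf nth_rcons ltnn eqxx.
Qed.

Lemma reach_and_family (F G : nat -> basis Q -> bool) c gs :
  (forall i, i < c -> xspan gs (F i)) -> (forall i, i < c -> xspan gs (G i)) ->
  exists2 hs, reach c gs hs & forall i, i < c -> xspan hs (fun x => F i x && G i x).
Proof.
elim: c gs => [|c IH] gs sF sG; first by exists gs => //; apply: reach0.
have [hs rh sh] := IH gs (fun i li => sF i (ltnW li)) (fun i li => sG i (ltnW li)).
have [ks rk sk] := reach_and (xspan_reach rh (sF c (ltnSn c))) (xspan_reach rh (sG c (ltnSn c))).
exists ks => [|i]; first by rewrite -addn1; apply: reach_trans rh rk.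
by rewrite ltnS leq_eqVlt => /predU1P [->|lt_i] //; apply: xspan_reach rk (sh _ lt_i).
Qed.

Lemma xspans_cons gs b bs : xspans gs (b :: bs) -> xspan gs b /\ xspans gs bs.
Proof. by move=> s; split; [exact: (s 0) | move=> i; exact: (s i.+1)]. Qed.

Lemma xspansI gs b bs : xspan gs b -> xspans gs bs -> xspans gs (b :: bs).
Proof. by move=> sb sbs [|i]; [exact: sb | exact: sbs]. Qed.

Lemma xspans_nil gs : xspans gs [::].
Proof. by move=> i; rewrite /nthf nth_nil; apply: xspan_false. Qed.

Lemma reach_map_and F G gs : xspans gs F -> xspans gs G -> size F = size G ->
  exists2 hs, reach (size F) gs hs &
    xspans hs [seq (fun x => p.1 x && p.2 x) | p <- zip F G].
Proof.
elim: F G gs => [|f F IH] [|g G] gs //= sF sG.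
  by exists gs; [apply: reach0 | apply: xspans_nil].
case=> /IH {}IH; have [[sf {}sF] [sg {}sG]] := (xspans_cons sF, xspans_cons sG).
have [hs rh sh] := reach_and sf sg.
have [ks rk sk] := IH hs (xspans_reach rh sF) (xspans_reach rh sG).
exists ks; first by rewrite -add1n; apply: reach_trans rh rk.
by apply: xspansI => //; apply: xspan_reach rk sh.
Qed.

(* Little-endian binary value. *)
Fixpoint bval bs (x : basis Q) : nat :=
  if bs is b :: bs' then b x + (bval bs' x).*2 else 0.

Lemma bval_rcons bs b x : bval (rcons bs b) x = bval bs x + b x * 2 ^ size bs.
Proof.
elim: bs => [|b' bs IH] /=; first by rewrite muln1 addn0.
by rewrite IH expnS; case: (b x); lia.
Qed.

Lemma bval_eq0 bs x : (bval bs x == 0) = all (fun b => ~~ b x) bs.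
Proof. by elim: bs => //= b bs <-; case: (b x); case: (bval bs x). Qed.

Lemma bval_lt bs x : bval bs x < 2 ^ size bs.
Proof. by elim: bs => //= b bs IH; rewrite expnS; case: (b x); lia. Qed.

(** The lowest bit must equal the parity of [c] and the other bits must encode [c./2]. Comparing a
    bit with a constant is affine, so only the conjunctions cost: one AND per bit. *)
Lemma reach_eq bs gs c : xspans gs bs ->
  exists2 hs, reach (size bs) gs hs & xspan hs (fun x => bval bs x == c).
Proof.
elim: bs c gs => [|b bs IH] c gs sbs.
  exists gs; first exact: reach0.
  by case: c => [|c]; [exact: xspan_true | exact: xspan_false].
have [sb {}sbs] := xspans_cons sbs.
have [hs rh sh] := IH c./2 gs sbs.
have sb' : xspan hs (fun x => b x (+) ~~ odd c).
  by apply: xspan_constx; apply: xspan_reach rh sb.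
have [ks rk sk] := reach_and sb' sh.
exists ks; first by rewrite /= -addn1; apply: reach_trans rh rk.
apply: xspan_ext sk => x /=; rewrite -{3}(odd_double_half c).
by case: (b x); case: (odd c) => /=; apply/idP/idP; lia.
Qed.

(** Recursion on the top bit, of weight [d]. If c < d, that bit must be 0 and the lower bits below
    c; otherwise it suffices that it is 0 or that the lower bits are below c - d. *)
Lemma reach_lt bs gs c : xspans gs bs ->
  exists2 hs, reach (size bs) gs hs & xspan hs (fun x => bval bs x < c).
Proof.
elim/last_ind: bs c gs => [|bs b IH] c gs sbs.
  exists gs; first exact: reach0.
  by case: c => [|c]; [exact: xspan_false | exact: xspan_true].
have sbs' : xspans gs bs.
  move=> i; have := sbs i; rewrite /nthf nth_rcons.
  have [//|/(nth_default (fun=> false)) ->] := ltnP i (size bs).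
  by move=> _; apply: xspan_false.
have sb : xspan gs b by have := sbs (size bs); rewrite /nthf nth_rcons ltnn eqxx.
rewrite size_rcons; set d := 2 ^ size bs.
have [hs rh sh] := IH (if c < d then c else c - d) gs sbs'.
(* Both cases are one AND up to constant negations: when d <= c, the disjunction is written by De
   Morgan. *)
have [ks rk sk] := reach_and (xspan_constx (c < d) (xspan_reach rh sb))
  (xspan_constx (d <= c) sh).
exists ks; first by rewrite -addn1; apply: reach_trans rh rk.
apply: xspan_ext (xspan_constx (d <= c) sk) => x; rewrite bval_rcons -/d.
have := bval_lt bs x; rewrite -/d; case: (ltnP c d) => cd; case: (b x) => /= bd.
all: rewrite ?addbF ?addbT ?andbT /= ?negbK; apply/idP/idP; lia.
Qed.

(** Binary tree of indicators with [r] at the root. The higher bits give the indicator of [i./2];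
    one AND with the lowest bit yields its odd child, and subtracting that from the parent yields
    the even child for free. Each level doubles the indicators, so the ANDs sum to [c] plus a
    rounding of one per level. *)
Lemma reach_decode bs gs c r : xspans gs bs -> xspan gs r ->
  exists2 hs, reach (c + size bs) gs hs &
    forall i, i < c -> xspan hs (fun x => r x && (bval bs x == i)).
Proof.
elim: bs c gs => [|b bs IH] c gs sbs sr.
  exists gs; first exact: reach_le (leq0n _) (reach0 gs).
  move=> [|i] _; first by apply: xspan_ext sr => x; rewrite andbT.
  by apply: xspan_ext (xspan_false _) => x; rewrite andbF.
have [sb {}sbs] := xspans_cons sbs.
have [hs rh sh] := IH (uphalf c) gs sbs sr.
have [ks rk sk] := reach_and_family sh (fun i _ => xspan_reach rh sb).
exists ks; first by apply: reach_le (reach_trans rh rk); rewrite /=; lia.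
move=> i lt_i; have lt_h : i./2 < uphalf c by lia.
have s1 := sk _ lt_h; have s0 := xspan_reach rk (sh _ lt_h).
case oi: (odd i); [apply: xspan_ext s1 | apply: xspan_ext (xspan_xor s0 s1)] => x /=;
  rewrite -[in RHS](odd_double_half i) oi;
  case: (b x); case: (r x) => /=; apply/idP/idP; lia.
Qed.

Notation pop F x := (count (fun f : basis Q -> bool => f x) F).

(** A chain of full adders: the running sum bit absorbs two summands at a time and each adder emits
    a carry of weight two. A half adder ends the chain when the number of summands is odd. *)
Lemma reach_carry F f gs : xspans gs F -> xspan gs f ->
  exists hs s G, [/\ reach (uphalf (size F)) gs hs, xspan hs s, xspans hs G,
    size G = uphalf (size F) & forall x, f x + pop F x = s x + (pop G x).*2].
Proof.
have [k] := ubnP (size F); elim: k F f gs => // k IH [|a [|b F]] f gs lt_k sF sf.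
- exists gs, f, [::]; split=> //; first exact: reach0.
- have [sa _] := xspans_cons sF.
  have [hs rh sh] := reach_and sf sa.
  exists hs, (fun x => f x (+) a x), [:: fun x => f x && a x]; split=> //.
  + by apply: xspan_xor; apply: xspan_reach rh _.
  + by apply: xspansI => //; apply: xspans_nil.
  + by move=> x /=; case: (f x); case: (a x).
- have [sa {}sF] := xspans_cons sF; have [sb {}sF] := xspans_cons sF.
  (* One AND per full adder: maj (f, a, b) = (f + a)(f + b) + f. *)
  have [hs rh sh] := reach_and (xspan_xor sf sa) (xspan_xor sf sb).
  have smaj := xspan_xor sh (xspan_reach rh sf).
  have sx : xspan hs (fun x => f x (+) (a x (+) b x)).
    by apply: xspan_reach rh _; do 2?apply: xspan_xor.
  have [|ks [s [G [rk ss sG zG eqG]]]] := IH F _ hs _ (xspans_reach rh sF) sx.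
    by move: lt_k => /=; lia.
  exists ks, s, ((fun x => (f x (+) a x) && (f x (+) b x) (+) f x) :: G); split=> //.
  + exact: reach_trans rh rk.
  + by apply: xspansI => //; apply: xspan_reach rk smaj.
  + by rewrite /= zG.
  + move=> x /=; have := eqG x.
    by case: (f x); case: (a x); case: (b x) => /=; lia.
Qed.

(** One pass of [reach_carry] gives the lowest bit; the carries, half as many, are counted
    recursively. The first summand starts the chain, so a pass over s + 1 bits and the recursion
    cost [uphalf s] each, at most s + 1 together. Padding to L + 1 bits makes the width depend on
    [L] alone. *)
Lemma reach_popcount L F gs : size F <= 2 ^ L -> xspans gs F ->
  exists hs bs, [/\ reach (size F) gs hs, xspans hs bs, size bs = L.+1 &
    forall x, bval bs x = pop F x].
Proof.
elim: L F gs => [|L IH] [|f F] gs sz sF.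
- exists gs, [:: fun=> false]; split=> //; first exact: reach0.
  by apply: xspansI; [apply: xspan_false | apply: xspans_nil].
- case: F sz sF => // _ sF; exists gs, [:: f]; split=> //.
  exact: reach_le (leq0n _) (reach0 gs).
- exists gs, (nseq L.+2 (fun=> false)); split; last first.
  + by move=> x; elim: L.+2 => //= n ->.
  + by rewrite size_nseq.
  + by move=> i; rewrite /nthf nth_nseq if_same; apply: xspan_false.
  + exact: reach0.
- have [sf {}sF] := xspans_cons sF.
  have [hs [s [G [rh ss sG zG eqG]]]] := reach_carry sF sf.
  have [|ks [bs [rk sbs zbs eqbs]]] := IH G hs _ sG.
    by move: sz; rewrite zG expnS /=; lia.
  exists ks, (s :: bs); split=> /=.
  + by apply: reach_le (reach_trans rh rk); rewrite zG; lia.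
  + by apply: xspansI => //; apply: xspan_reach rk ss.
  + by rewrite zbs.
  + by move=> x; rewrite eqbs -eqG.
Qed.

(** Stored products stay valid while qubits outside [I] are modified. *)
Lemma xspan_local gs f : ext [::] gs -> xspan gs f ->
  forall x y : basis Q, (forall q, I q -> x q = y q) -> f x = f y.
Proof.
move=> e sf x y xy.
have loc hs g : (forall i, nthf hs i x = nthf hs i y) -> xspan hs g -> g x = g y.
  move=> hh; elim=> {g} [q /xy //|i //||g h _ gg _ hh'|g h gh _ gg] //.
    by rewrite gg hh'.
  by rewrite -!gh.
apply: (loc gs) sf; elim: e => [|hs g h _ IH sg sh] i; first by rewrite /nthf !nth_nil.
rewrite /nthf nth_rcons; case: ltnP => _; first exact: IH.
by case: eqP => // _; rewrite (loc hs g) // (loc hs h).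
Qed.

End StraightLine.

Local Open Scope ring_scope.
Local Open Scope sesquilinear_scope.

(** * Matrix entries indexed by basis states *)

Section Matrices.
Variable C : numClosedFieldType.
Implicit Types Q : finType.

Definition ent Q Q' (A : 'M[C]_(dim Q', dim Q)) (y : basis Q') (x : basis Q) : C :=
  A (enum_rank y) (enum_rank x).

Lemma ent_inj Q Q' (A B : 'M[C]_(dim Q', dim Q)) :
  (forall y x, ent A y x = ent B y x) -> A = B.
Proof.
move=> AB; apply/matrixP => i j.
by rewrite -(enum_valK i) -(enum_valK j); apply: AB.
Qed.

Lemma ent_mul Q1 Q2 Q3 (A : 'M[C]_(dim Q3, dim Q2)) (B : 'M[C]_(dim Q2, dim Q1)) y x :
  ent (A *m B) y x = \sum_z ent A y z * ent B z x.
Proof.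
rewrite /ent mxE (reindex (@enum_rank _)) //=.
by exists enum_val => i _; rewrite ?enum_rankK ?enum_valK.
Qed.

Lemma ketE Q (x y : basis Q) : ket C x (enum_rank y) 0 = (y == x)%:R.
Proof. by rewrite /ket mxE eqxx andbT (inj_eq enum_rank_inj). Qed.

Lemma ent_linmap Q Q' (f : basis Q -> 'cV[C]_(dim Q')) y x :
  ent (linmap f) y x = f x (enum_rank y) 0.
Proof. by rewrite /ent mxE enum_rankK. Qed.

Lemma ent_adj Q Q' (A : 'M[C]_(dim Q', dim Q)) y x :
  ent (A^t*) y x = (ent A x y)^*.
Proof. by rewrite /ent !mxE. Qed.

Lemma ent_one Q (y x : basis Q) : ent (1%:M : 'M[C]_(dim Q)) y x = (y == x)%:R.
Proof. by rewrite /ent mxE (inj_eq enum_rank_inj). Qed.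

Lemma entZ Q Q' c (A : 'M[C]_(dim Q', dim Q)) y x : ent (c *: A) y x = c * ent A y x.
Proof. exact: mxE. Qed.

Lemma entD Q Q' (A B : 'M[C]_(dim Q', dim Q)) y x : ent (A + B) y x = ent A y x + ent B y x.
Proof. exact: mxE. Qed.

Lemma entN Q Q' (A : 'M[C]_(dim Q', dim Q)) y x : ent (- A) y x = - ent A y x.
Proof. exact: mxE. Qed.

Lemma ent_tensor Q Q' (A : 'M[C]_(dim Q)) (B : 'M[C]_(dim Q')) y x :
  ent (tensor A B) y x
  = ent A (lpart y) (lpart x) * ent B (rpart y) (rpart x).
Proof. by rewrite /ent mxE !enum_rankK. Qed.

Lemma mul_ket Q Q' (A : 'M[C]_(dim Q', dim Q)) x y :
  (A *m ket C x) (enum_rank y) 0 = ent A y x.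
Proof. by rewrite -colE mxE. Qed.

Lemma ket_inj Q Q' (A B : 'M[C]_(dim Q', dim Q)) :
  (forall x, A *m ket C x = B *m ket C x) -> A = B.
Proof. by move=> AB; apply: ent_inj => y x; rewrite -!mul_ket AB. Qed.

Lemma linmap_ket Q Q' (f : basis Q -> 'cV[C]_(dim Q')) x :
  linmap f *m ket C x = f x.
Proof.
apply/colP => i; rewrite -(enum_valK i); move: (enum_val i) => y.
by rewrite mul_ket ent_linmap.
Qed.

(** The common shape of diagonal phases, reversible classical gates and controlled signed bit
    flips. *)
Definition monomial Q (c : basis Q -> C) (p : basis Q -> basis Q) : 'M[C]_(dim Q) :=
  linmap (fun x => c x *: ket C (p x)).

Lemma ent_monomial Q c (p : basis Q -> basis Q) y x :
  ent (monomial c p) y x = c x * (y == p x)%:R.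
Proof. by rewrite ent_linmap mxE ketE. Qed.

Lemma monomial_unitary Q c (p : basis Q -> basis Q) :
  injective p -> (forall x, (c x)^* * c x = 1) -> monomial c p \is unitarymx.
Proof.
move=> p_inj c1; rewrite -trmxC_unitary; apply/unitarymxP; rewrite trmxCK.
apply: ent_inj => y x; rewrite ent_mul ent_one (bigD1 (p x)) //= big1 => [|z zpx].
  rewrite addr0 ent_adj !ent_monomial eqxx mulr1 rmorphM rmorph_nat (inj_eq p_inj).
  rewrite eq_sym; case: eqP => [->|_]; first by rewrite mulr1 c1.
  by rewrite mulr0 mul0r.
by rewrite !ent_monomial (negPf zpx) !mulr0.
Qed.

End Matrices.

(** * Measurement-free circuits and layers of Hadamard gates *)

Section Circuits.
Variables (C : numClosedFieldType) (Q : finType).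
Implicit Types (g : gate Q) (gs : seq (gate Q)) (x y : basis Q).

Definition is_toffoli g : bool := if g is Toffoli _ _ _ _ then true else false.
Definition classical g : bool :=
  match g with CNOT _ _ _ | Toffoli _ _ _ _ => true | _ => false end.

Definition act g x : basis Q :=
  match g with
  | CNOT a t _ => set_bit x t (x t (+) x a)
  | Toffoli a b t _ => set_bit x t (x t (+) (x a && x b))
  | _ => x
  end.

Definition acts gs x := foldl (fun y g => act g y) x gs.

(** The head of the list acts first, hence is the rightmost factor. *)
Definition run gs : 'M[C]_(dim Q) := foldr (fun g A => A *m gate_mx C g) 1%:M gs.

Definition circuit_of gs : circuit Q := foldr (@Apply Q) Stop gs.

Lemma kraus_circuit_of gs : kraus C (circuit_of gs) = [:: run gs].
Proof. by elim: gs => //= g gs ->. Qed.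

Lemma toffoli_circuit_of gs : toffoli_count (circuit_of gs) = count is_toffoli gs.
Proof. by elim: gs => //= g gs ->; case: g. Qed.

Lemma run_cat gs gs' : run (gs ++ gs') = run gs' *m run gs.
Proof. by elim: gs => [|g gs IH] /=; rewrite ?mulmx1 // IH mulmxA. Qed.

Lemma set_bitE x q b r : set_bit x q b r = if r == q then b else x r.
Proof. by rewrite ffunE. Qed.

Lemma set_bit_id x q : set_bit x q (x q) = x.
Proof. by apply/ffunP => r; rewrite ffunE; case: eqP => // ->. Qed.

Lemma set_bit_set x q b c : set_bit (set_bit x q b) q c = set_bit x q c.
Proof. by apply/ffunP => r; rewrite !ffunE; case: eqP. Qed.

Lemma actK g : involutive (act g).
Proof.
case: g => //= [a t at_|a b t].
  by move=> x; rewrite /= set_bit_set !set_bitE eqxx (negPf at_) addbK set_bit_id.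
move=> abt x; rewrite /= set_bit_set !set_bitE eqxx.
have /and3P [] := abt; rewrite !inE negb_or => /andP [_ /negPf ->] /negPf -> _.
by rewrite addbK set_bit_id.
Qed.

Lemma acts_revK gs x : acts (rev gs) (acts gs x) = x.
Proof.
elim: gs x => //= g gs IH x; rewrite rev_cons -cats1 /acts foldl_cat /=.
by rewrite -/(acts (rev gs) _) IH actK.
Qed.

Lemma gate_classical g x : classical g -> gate_mx C g *m ket C x = ket C (act g x).
Proof. by case: g => //= *; rewrite linmap_ket. Qed.

Lemma run_classical gs x : all classical gs -> run gs *m ket C x = ket C (acts gs x).
Proof.
elim: gs x => [|g gs IH] x /=; first by rewrite mul1mx.
by case/andP=> cg cgs; rewrite -mulmxA gate_classical // IH.
Qed.

(** [l] lists the qubits on which [x] and [y] may differ. *)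
Definition agree (l : seq Q) x y := [forall q, (q \notin l) ==> (x q == y q)].

Lemma agreeP l x y : reflect (forall q, q \notin l -> x q = y q) (agree l x y).
Proof.
apply: (iffP forallP) => xy q; first by move=> ql; apply/eqP; have /implyP := xy q; apply.
by apply/implyP => ql; rewrite xy.
Qed.

Lemma agree_sym l x y : agree l x y = agree l y x.
Proof. by apply/agreeP/agreeP => xy q /xy. Qed.

Lemma agree_trans l : transitive (agree l).
Proof. by move=> y x z /agreeP xy /agreeP yz; apply/agreeP => q ql; rewrite xy ?yz. Qed.

Local Notation r2 := ((sqrtC 2)^-1 : C).

Lemma ent_had (q : Q) y x : ent (gate_mx C (Hadamard q)) y x
  = r2 * (agree [:: q] y x)%:R * (-1) ^+ (y q && x q).
Proof.
rewrite ent_linmap mxE [X in _ * X]mxE [X in _ * (_ + X)]mxE !ketE -mulrA; congr (_ * _).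
have eq_set b : (y == set_bit x q b) = (y q == b) && agree [:: q] y x.
  apply/eqP/andP => [->|[/eqP yq /agreeP yx]].
    rewrite set_bitE eqxx; split=> //; apply/agreeP => r.
    by rewrite inE set_bitE => /negPf ->.
  apply/ffunP => r; rewrite set_bitE; case: eqP => [->|/eqP rq] //.
  by rewrite yx // inE.
rewrite !eq_set; case: (agree _ _ _); last by rewrite !andbF mulr0 addr0 mul0r.
by case: (y q); case: (x q); rewrite /= ?expr0 ?expr1; ring.
Qed.

Lemma r2_real : r2^* = r2.
Proof. by apply/CrealP; rewrite rpredV ger0_real // sqrtC_ge0 ler0n. Qed.

Lemma r2_sqr : r2 * r2 = 2^-1.
Proof. by rewrite -invfM -expr2 sqrtCK. Qed.

Lemma signb_real (b : bool) : ((-1 : C) ^+ b)^* = (-1) ^+ b.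
Proof. by rewrite rmorphXn rmorphN1. Qed.

Lemma had_herm (q : Q) : (gate_mx C (Hadamard q))^t* = gate_mx C (Hadamard q).
Proof.
apply: ent_inj => y x; rewrite ent_adj !ent_had !rmorphM /= r2_real rmorph_nat signb_real.
by rewrite agree_sym andbC.
Qed.

Lemma hadK (q : Q) : gate_mx C (Hadamard q) *m gate_mx C (Hadamard q) = 1%:M.
Proof.
apply: ket_inj => x; rewrite mul1mx -mulmxA linmap_ket -scalemxAr mulmxDr -scalemxAr.
rewrite !linmap_ket !set_bit_set !set_bitE eqxx expr0 expr1 scale1r scaleN1r.
have h : r2 * r2 * 2 = 1 by rewrite r2_sqr mulVf // pnatr_eq0.
have := set_bit_id x q; case: (x q) => e; rewrite -[in RHS]e {e};
  move: (ket C (set_bit x q false)) (ket C (set_bit x q true)) => u v;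
  rewrite ?expr0 ?expr1 ?scale1r ?scaleN1r -?scalerBr -?scalerDr scalerA.
  by rewrite opprB addrC addrA subrK -mulr2n -scaler_nat scalerA h scale1r.
by rewrite addrACA subrr addr0 -mulr2n -scaler_nat scalerA h scale1r.
Qed.

Lemma gate_unitary g : gate_mx C g \is unitarymx.
Proof.
case: g => [q|q|a t h|a b t h].
- by apply/unitarymxP; rewrite had_herm hadK.
- apply: (@monomial_unitary _ _ (fun x => 'i ^+ x q) id) => // x.
  by rewrite rmorphXn /= conjCi -exprMn mulNr -expr2 sqrCi opprK expr1n.
- rewrite [gate_mx _ _](_ : _ = monomial (fun=> 1) (act (CNOT h))); last first.
    by congr linmap; apply/funext => x; rewrite scale1r.
  by apply: monomial_unitary => [|x]; [apply: inv_inj; apply: actK | rewrite conjC1 mulr1].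
- rewrite [gate_mx _ _](_ : _ = monomial (fun=> 1) (act (Toffoli h))); last first.
    by congr linmap; apply/funext => x; rewrite scale1r.
  by apply: monomial_unitary => [|x]; [apply: inv_inj; apply: actK | rewrite conjC1 mulr1].
Qed.

Lemma run_unitary gs : run gs \is unitarymx.
Proof.
elim: gs => [|g gs IH] /=; first by apply/unitarymxP; rewrite mul1mx trmx1 map_mx1.
by apply: mul_unitarymx => //; apply: gate_unitary.
Qed.

Definition hadl (l : seq Q) := run [seq Hadamard q | q <- l].

Definition hsign (l : seq Q) y x : C := \prod_(q <- l) (-1) ^+ (y q && x q).

(** The kernel of the Walsh-Hadamard transform on the qubits of [l]. *)
Lemma ent_hadl l y x : uniq l ->
  ent (hadl l) y x = r2 ^+ size l * (agree l y x)%:R * hsign l y x.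
Proof.
rewrite /hadl; elim: l x => [|q l IH] x /=.
  have -> : agree [::] y x = (y == x).
    by apply/agreeP/eqP => [yx|->] //; apply/ffunP => q; apply: yx.
  by rewrite ent_one /hsign big_nil expr0 mul1r mulr1.
(* A single intermediate state contributes: qubit [q] is not touched again, so it already has its
   final value, and all others are still those of [x]. *)
case/andP=> ql ul; rewrite ent_mul (bigD1 (set_bit x q (y q))) //= big1 => [|z zx].
  rewrite addr0 IH // ent_had.
  have -> : agree [:: q] (set_bit x q (y q)) x.
    by apply/agreeP => r; rewrite inE set_bitE => /negPf ->.
  have -> : agree l y (set_bit x q (y q)) = agree (q :: l) y x.
    apply/agreeP/agreeP => yx r; last first.
      by rewrite set_bitE; case: eqP => [->|/eqP rq rl] //; apply: yx; rewrite inE negb_or rq.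
    by rewrite inE negb_or => /andP [/negPf rq] /yx; rewrite set_bitE rq.
  rewrite /hsign big_cons exprS set_bitE eqxx.
  have -> : \prod_(j <- l) (-1 : C) ^+ (y j && set_bit x q (y q) j) =
            \prod_(j <- l) (-1) ^+ (y j && x j).
    rewrite big_seq [RHS]big_seq; apply: eq_bigr => j jl; rewrite set_bitE.
    by case: eqP jl ql => // -> ->.
  by rewrite (mulr1n 1) mulr1; ring.
rewrite IH // ent_had.
case yz: (agree l y z); last by rewrite mulr0 !mul0r.
case zx': (agree _ z x); last by rewrite mulr0 mul0r mulr0.
case/eqP: zx; apply/ffunP => r; rewrite set_bitE; case: eqP => [->|/eqP rq].
  by rewrite (agreeP _ _ _ yz).
by rewrite (agreeP _ _ _ zx') // inE.
Qed.

Lemma hadl_herm l : uniq l -> (hadl l)^t* = hadl l.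
Proof.
move=> ul; apply: ent_inj => y x; rewrite ent_adj !ent_hadl // !rmorphM rmorphXn /=.
rewrite r2_real rmorph_nat agree_sym; congr (_ * _); rewrite /hsign rmorph_prod.
by apply: eq_bigr => q _; rewrite /= signb_real andbC.
Qed.

Lemma hadlK l : uniq l -> hadl l *m hadl l = 1%:M.
Proof. by move=> ul; rewrite -[X in _ *m X]hadl_herm //; apply/unitarymxP/run_unitary. Qed.

End Circuits.

(** * Pauli X and controlled Z from the Clifford generators *)

Section Macros.
Variables (C : numClosedFieldType) (W : finType).

Lemma imagC2 : 'i * 'i = -1 :> C.
Proof. by rewrite -expr2 sqrCi. Qed.

(** X = H Z H with Z = S^2. *)
Lemma x_gate (q : W) : exists gl, count (@is_toffoli _) gl = 0%N /\
  forall z, run C gl *m ket C z = ket C (set_bit z q (~~ z q)).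
Proof.
exists [:: Hadamard q; Phase q; Phase q; Hadamard q]; split=> // z.
have phase2 y : gate_mx C (Phase q) *m (gate_mx C (Phase q) *m ket C y) = (-1) ^+ y q *: ket C y.
  by rewrite linmap_ket -scalemxAr linmap_ket scalerA -exprMn imagC2.
rewrite /= mul1mx -!mulmxA linmap_ket -!scalemxAr !mulmxDr -!scalemxAr !phase2.
rewrite !set_bitE eqxx expr0 expr1 !scale1r scaleN1r mulmxN scalerN.
rewrite !linmap_ket !set_bit_set !set_bitE eqxx expr0 expr1 scale1r scaleN1r.
have rr : (sqrtC 2)^-1 * (sqrtC 2)^-1 * 2 = 1 :> C by rewrite r2_sqr mulVf // pnatr_eq0.
case: (z q) => /=; rewrite ?expr0 ?expr1 ?scale1r ?scaleN1r ?opprK;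
  move: (ket C (set_bit z q false)) (ket C (set_bit z q true)) => u v.
  by rewrite -scalerDr addrACA subrr addr0 scalerA -mulr2n -scaler_nat scalerA rr scale1r.
rewrite -scalerBr opprB [u + v]addrC addrACA subrr addr0 scalerA -mulr2n.
by rewrite -scaler_nat scalerA rr scale1r.
Qed.

(** With S^3 = S^-1 applied to the parity of the two bits, the phase is i^(a + t - (a xor t)) = i^(2
    a t) = (-1)^(a t). *)
Lemma cz_gate (a t : W) : a != t -> exists gl, count (@is_toffoli _) gl = 0%N /\
  forall z, run C gl *m ket C z = (-1) ^+ (z a && z t) *: ket C z.
Proof.
move=> at_.
exists [:: Phase a; Phase t; CNOT at_; Phase t; Phase t; Phase t; CNOT at_]; split=> // z.
rewrite /= mul1mx -!mulmxA.
do !rewrite linmap_ket -?scalemxAr ?set_bit_set ?set_bitE ?eqxx ?(negPf at_).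
rewrite addbK set_bit_id !scalerA; congr (_ *: _).
case: (z a); case: (z t); rewrite /= ?expr0 ?expr1 ?mulr1 ?mul1r ?imagC2 //.
all: by rewrite -mulrA imagC2 mulrNN mulr1.
Qed.
End Macros.

(** * Compiling straight-line programs to circuits that restore their work qubits *)

Section Implementation.
Variables (C : numClosedFieldType) (Q : finType).
Implicit Types (x y : basis Q).

Definition app0 w x : basis (Q + 'I_w)%type :=
  [ffun r => if r is inl q then x q else false].

Lemma append0_ket w x : append0 C Q w *m ket C x = ket C (app0 w x).
Proof. by rewrite linmap_ket. Qed.

Lemma app0_inj w : injective (@app0 w).
Proof.
by move=> x y /ffunP xy; apply/ffunP => q; have := xy (inl q); rewrite !ffunE.
Qed.

Lemma append0_iso w : (append0 C Q w)^t* *m append0 C Q w = 1%:M.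
Proof.
apply: ent_inj => y x; rewrite ent_mul ent_one (bigD1 (app0 w x)) //= big1 => [|z zx].
  rewrite addr0 ent_adj !ent_linmap !ketE eqxx mulr1 rmorph_nat.
  by rewrite (inj_eq (@app0_inj w)) eq_sym.
by rewrite [X in _ * X]ent_linmap ketE -/(app0 w x) (negPf zx) mulr0.
Qed.

(** Exact equality, without the scalar that [implements] allows, so that implementations compose
    directly. *)
Definition impl w (gs : seq (gate (Q + 'I_w)%type)) (U : 'M[C]_(dim Q)) :=
  run C gs *m append0 C Q w = append0 C Q w *m U.

Lemma impl_cat w (gs gs' : seq (gate (Q + 'I_w)%type)) U U' :
  impl gs U -> impl gs' U' -> impl (gs ++ gs') (U' *m U).
Proof. by move=> h h'; rewrite /impl run_cat -mulmxA h mulmxA h' mulmxA. Qed.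

(** Appending zeros is an isometry and the circuit is unitary, so U^dagger U = 1; as [U] is square,
    this is unitarity. *)
Lemma impl_unitary w (gs : seq (gate (Q + 'I_w)%type)) U :
  impl gs U -> U \is unitarymx.
Proof.
move=> h; rewrite -trmxC_unitary; apply/unitarymxP; rewrite trmxCK.
have adjM n1 n2 n3 (A : 'M[C]_(n1, n2)) (B : 'M[C]_(n2, n3)) :
    (A *m B)^t* = B^t* *m A^t* by rewrite trmx_mul map_mxM.
have KK : (run C gs)^t* *m run C gs = 1%:M.
  exact/mulmx1C/unitarymxP/run_unitary.
rewrite -[U in _ *m U]mul1mx -(append0_iso w) mulmxA mulmxA -adjM -mulmxA -h adjM.
by rewrite mulmxA -(mulmxA _ _ (run C gs)) KK mulmx1 append0_iso.
Qed.

Lemma impl_hadl w (l : seq Q) : impl [seq @Hadamard (Q + 'I_w)%type (inl q) | q <- l] (hadl C l).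
Proof.
elim: l => [|q l IH]; first by rewrite /impl /hadl /= mul1mx mulmx1.
rewrite /= -cat1s [hadl _ _]/=; apply: (@impl_cat _ [:: _]) => //.
apply: ket_inj => x; rewrite /= mul1mx -!mulmxA append0_ket !linmap_ket.
rewrite -!scalemxAr !mulmxDr -!scalemxAr !append0_ket.
have app_set b : set_bit (app0 w x) (inl q) b = app0 w (set_bit x q b).
  by apply/ffunP => -[r|i]; rewrite !ffunE.
by rewrite !app_set ffunE.
Qed.

Variables (I : pred Q) (d : nat).
Local Notation w := d.+3.
Local Notation W := (Q + 'I_w)%type.
Implicit Types (gs : seq (basis Q -> bool)) (cg : seq (gate W)).

(* Work wire 0 holds the constant one, wires 1 and 2 are scratch, and wire i + 3 holds gs_i. *)
Definition layout gs x (b1 b2 : bool) : basis W :=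
  [ffun r => match r with
    | inl q => x q
    | inr i => match nat_of_ord i with
               | 0 => true | 1 => b1 | 2 => b2 | j.+3 => nthf gs j x end
    end].

Definition wone : W := inr (@Ordinal w 0 isT).
Definition scr1 : W := inr (@Ordinal w 1 isT).
Definition scr2 : W := inr (@Ordinal w 2 isT).

Lemma layout1 gs x b1 b2 b : set_bit (layout gs x b1 b2) scr1 b = layout gs x b b2.
Proof. by apply/ffunP => -[q|[[|[|[|i]]] lt_i]]; rewrite !ffunE. Qed.

Lemma layout2 gs x b1 b2 b : set_bit (layout gs x b1 b2) scr2 b = layout gs x b1 b.
Proof. by apply/ffunP => -[q|[[|[|[|i]]] lt_i]]; rewrite !ffunE. Qed.

Lemma layout_set gs x b1 b2 q b : (forall i, nthf gs i (set_bit x q b) = nthf gs i x) ->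
  set_bit (layout gs x b1 b2) (inl q) b = layout gs (set_bit x q b) b1 b2.
Proof. by move=> h; apply/ffunP => -[r|[[|[|[|i]]] lt_i]]; rewrite !ffunE. Qed.

Lemma xspan_wires gs f : xspan I gs f -> (size gs <= d)%N ->
  exists l : seq W, [/\ scr1 \notin l, scr2 \notin l &
    forall x b1 b2, f x = foldr addb false [seq layout gs x b1 b2 r | r <- l]].
Proof.
move=> sf le_d; elim: {f} sf => [q _|i||f g _ [l [l1 l2 fl]] _ [l' [l1' l2' gl]]|f g fg _ [l [l1 l2 fl]]].
- by exists [:: inl q]; split=> // x b1 b2; rewrite /= ffunE addbF.
- have [lt_i|le_i] := ltnP i (size gs).
    have lt_iw : (i.+3 < w)%N by rewrite !ltnS (leq_trans lt_i).
    by exists [:: inr (Ordinal lt_iw)]; split=> // x b1 b2; rewrite /= ffunE addbF.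
  by exists [::]; split=> // x b1 b2; rewrite /nthf nth_default.
- by exists [:: wone]; split=> // x b1 b2; rewrite /= ffunE.
- exists (l ++ l'); split; rewrite ?mem_cat ?negb_or ?l1 ?l2 // => x b1 b2.
  rewrite (fl x b1 b2) (gl x b1 b2) map_cat foldr_cat.
  by elim: l {l1 l2 fl} => //= r l IH; rewrite -addbA IH.
- by exists l; split=> // x b1 b2; rewrite -fg.
Qed.

Lemma copy_wires (l : seq W) t : t \notin l ->
  exists cg, [/\ all (@classical _) cg, count (@is_toffoli _) cg = 0%N &
    forall z, acts cg z = set_bit z t (z t (+) foldr addb false [seq z r | r <- l])].
Proof.
elim: l => [|r l IH]; first by exists [::]; split=> // z; rewrite /= addbF set_bit_id.
rewrite inE negb_or eq_sym => /andP [rt tl]; have [cg [c1 c2 c3]] := IH tl.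
exists (CNOT rt :: cg); split=> //= z; rewrite /acts /= -/(acts cg _) c3 set_bit_set.
rewrite set_bitE eqxx -addbA; congr (set_bit _ _ (_ (+) (_ (+) foldr _ _ _))).
apply/eq_in_map => s sl; rewrite set_bitE; case: eqP sl tl => // -> ->.
by [].
Qed.

Lemma copy1 gs f : xspan I gs f -> (size gs <= d)%N ->
  exists cg, [/\ all (@classical _) cg, count (@is_toffoli _) cg = 0%N &
    forall x b1 b2, acts cg (layout gs x b1 b2) = layout gs x (b1 (+) f x) b2].
Proof.
move=> sf le_d; have [l [l1 l2 fl]] := xspan_wires sf le_d.
have [cg [c1 c2 c3]] := copy_wires l1; exists cg; split=> // x b1 b2.
by rewrite c3 -fl layout1 ffunE.
Qed.

Lemma copy2 gs f : xspan I gs f -> (size gs <= d)%N ->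
  exists cg, [/\ all (@classical _) cg, count (@is_toffoli _) cg = 0%N &
    forall x b1 b2, acts cg (layout gs x b1 b2) = layout gs x b1 (b2 (+) f x)].
Proof.
move=> sf le_d; have [l [l1 l2 fl]] := xspan_wires sf le_d.
have [cg [c1 c2 c3]] := copy_wires l2; exists cg; split=> // x b1 b2.
by rewrite c3 -fl layout2 ffunE.
Qed.

Lemma acts_cat cg cg' z : acts (cg ++ cg') z = acts cg' (acts cg z).
Proof. exact: foldl_cat. Qed.

(** For each product, the two factors are copied to the scratch wires, one Toffoli writes their
    product to a fresh wire, and the copies are erased. *)
Lemma compile gs : ext I [::] gs -> (size gs <= d)%N ->
  exists cg, [/\ all (@classical _) cg, count (@is_toffoli _) cg = size gs &
    forall x, acts cg (layout [::] x false false) = layout gs x false false].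
Proof.
elim=> [|{}gs f g e IH sf sg]; first by exists [::].
rewrite size_rcons => lt_d; have [cg [c1 c2 c3]] := IH (ltnW lt_d).
have [cf [f1 f2 f3]] := copy1 sf (ltnW lt_d).
have [ch [h1 h2 h3]] := copy2 sg (ltnW lt_d).
have e' : ext I gs (rcons gs (fun x => f x && g x)).
  by apply: ext_and sf sg; apply: ext_refl.
have le_d : (size (rcons gs (fun x => f x && g x)) <= d)%N by rewrite size_rcons.
have [cf' [f1' f2' f3']] := copy1 (xspan_mono e' sf) le_d.
have [ch' [h1' h2' h3']] := copy2 (xspan_mono e' sg) le_d.
have lt_w : ((size gs).+3 < w)%N by [].
have ut : uniq [:: scr1; scr2; inr (Ordinal lt_w) : W] by [].
exists (cg ++ (cf ++ ch) ++ Toffoli ut :: (ch' ++ cf')); split.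
- by rewrite !all_cat /= all_cat c1 f1 h1 f1' h1'.
- by rewrite !count_cat /= count_cat c2 f2 h2 f2' h2'; lia.
move=> x; rewrite !acts_cat c3 f3 h3 /acts [foldl _ _ (_ :: _)]/= -!/(acts _ _) acts_cat.
set z := set_bit _ _ _.
have -> : z = layout (rcons gs (fun x => f x && g x)) x (f x) (g x).
  apply/ffunP => -[q|[i lt_i]]; rewrite !ffunE //.
  have -> : (inr (Ordinal lt_i) == inr (Ordinal lt_w) :> W) = (i == (size gs).+3) by [].
  case: i lt_i => [|[|[|i]]] lt_i //=; rewrite !eqSS /nthf nth_rcons.
  by case: ltngtP => [|gt_i|_] //; rewrite nth_default // ltnW.
by rewrite h3' f3' !addbb.
Qed.

Lemma app0_layout x : set_bit (app0 w x) wone true = layout [::] x false false.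
Proof.
apply/ffunP => -[q|[[|[|[|i]]] lt_i]]; rewrite !ffunE //.
by rewrite /= /nthf nth_nil.
Qed.

(* The embedding of Q holding the values gs in the work wires. *)
Definition held gs : 'M[C]_(dim W, dim Q) :=
  linmap (fun x => ket C (layout gs x false false)).

Definition midimpl gs cg (U : 'M[C]_(dim Q)) := run C cg *m held gs = held gs *m U.

Lemma midimpl_cat gs cg cg' U U' :
  midimpl gs cg U -> midimpl gs cg' U' -> midimpl gs (cg ++ cg') (U' *m U).
Proof. by move=> h h'; rewrite /midimpl run_cat -mulmxA h mulmxA h' mulmxA. Qed.

(** Compute the products, act, uncompute: each AND is paid for twice. X gates switch the constant
    wire on and off. *)
Lemma impl_sandwich gs cg U : ext I [::] gs -> (size gs <= d)%N -> midimpl gs cg U ->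
  exists gl, count (@is_toffoli _) gl = (2 * size gs + count (@is_toffoli _) cg)%N
    /\ @impl w gl U.
Proof.
move=> e le_d mU; have [cc [c1 c2 c3]] := compile e le_d.
have [xg [x1 x2]] := x_gate C wone.
exists ((xg ++ cc) ++ cg ++ (rev cc ++ xg)); split.
  by rewrite !count_cat count_rev x1 c2; lia.
have pre : run C (xg ++ cc) *m append0 C Q w = held gs.
  apply: ket_inj => x; rewrite -mulmxA append0_ket linmap_ket run_cat -mulmxA x2.
  by rewrite run_classical // [X in ~~ X]ffunE app0_layout c3.
have post : run C (rev cc ++ xg) *m held gs = append0 C Q w.
  apply: ket_inj => x; rewrite -mulmxA append0_ket linmap_ket run_cat -mulmxA.
  rewrite run_classical ?all_rev // -c3 acts_revK x2 -app0_layout set_bit_set set_bitE eqxx.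
  by rewrite (_ : ~~ true = app0 w x wone) ?set_bit_id // ffunE.
by rewrite /impl 2!run_cat -!mulmxA pre mU mulmxA post.
Qed.

(** The value of [f] is copied to a scratch wire, where it serves as the control. Since [p]
    preserves [f], the same copy afterwards clears that wire. *)
Lemma midimpl_ctrl gs f cg (c : basis Q -> C) (p : basis Q -> basis Q) :
  xspan I gs f -> (size gs <= d)%N -> count (@is_toffoli _) cg = 0%N ->
  (forall x, f (p x) = f x) ->
  (forall x b, run C cg *m ket C (layout gs x b false)
     = (if b then c x else 1) *: ket C (layout gs (if b then p x else x) b false)) ->
  exists cg', count (@is_toffoli _) cg' = 0%N /\
    midimpl gs cg' (monomial (fun x => if f x then c x else 1)
                             (fun x => if f x then p x else x)).
Proof.
move=> sf le_d cg0 fp hcg; have [cc [c1 c2 c3]] := copy1 sf le_d.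
exists (cc ++ cg ++ cc); split; first by rewrite !count_cat c2 cg0.
apply: ket_inj => x; rewrite -!mulmxA !linmap_ket -scalemxAr linmap_ket !run_cat -!mulmxA.
rewrite run_classical // c3 hcg -scalemxAr run_classical // c3.
by case fx: (f x); rewrite ?fp ?fx.
Qed.

(** Two S gates form a Z on the scratch wire holding [f], which turns the value into a sign. *)
Lemma impl_phase gs f : ext I [::] gs -> (size gs <= d)%N -> xspan I gs f ->
  exists gl, count (@is_toffoli _) gl = (2 * size gs)%N
    /\ @impl w gl (monomial (fun x => (-1) ^+ f x) id).
Proof.
move=> e le_d sf.
have [|||cg [cg0 mcg]] := @midimpl_ctrl gs f [:: Phase scr1; Phase scr1] (fun=> -1) id sf le_d.
- by [].
- by [].
- move=> x b; rewrite /= mul1mx -mulmxA linmap_ket -scalemxAr linmap_ket scalerA.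
  by rewrite -exprMn imagC2 ffunE /=; case: b; rewrite ?expr0 ?expr1.
have [gl [gl2 igl]] := impl_sandwich e le_d mcg.
exists gl; split; first by rewrite gl2 cg0 addn0.
congr (impl _ _): igl; congr linmap; apply/funext => x.
by case: (f x).
Qed.

End Implementation.

(** * Recognising cliques and the reflection about them *)

Section Reflection.
Variables (C : numClosedFieldType) (a n : nat).
Implicit Types (z : basis ('I_a + 'I_n)%type) (x : basis 'I_n).

Local Notation anyq := (fun _ : ('I_a + 'I_n)%type => true).

Lemma xspans_inputs (Q : finType) (I : pred Q) gs (T : Type) (h : T -> Q) s :
  (forall v, I (h v)) -> xspans I gs [seq (fun z : basis Q => z (h v)) | v <- s].
Proof.
move=> Ih; elim: s => [|v s IH]; first exact: xspans_nil.
by apply: xspansI => //; apply: xspan_input.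
Qed.

Lemma card_vertices x : #|vertices x| = count (fun v => x v) (enum 'I_n).
Proof.
by rewrite cardE size_filter enumT; apply: eq_count => v; rewrite /= inE.
Qed.

Definition inside (A : {set {set 'I_n}}) x := count (fun p : {set _} => p \subset vertices x) (enum A).

(** Named endpoints let the presence of a pair be computed by one AND of two vertex qubits. *)
Lemma pairs_of (A : {set {set 'I_n}}) :
  (forall p, p \in A -> exists u v, p = [set u; v]) ->
  exists s : seq ('I_n * 'I_n), enum A = [seq [set q.1; q.2] | q <- s].
Proof.
move=> hA; have {hA}: forall p, p \in enum A -> exists u v, p = [set u; v].
  by move=> p; rewrite mem_enum => /hA.
elim: (enum A) => [|p s IH] hs; first by exists [::].
have [|t ->] := IH; first by move=> q qs; apply: hs; rewrite inE qs orbT.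
have [|u [v ->]] := hs p; first by rewrite inE eqxx.
by exists ((u, v) :: t).
Qed.

Lemma card_pairs (A : {set {set 'I_n}}) :
  (forall p, p \in A -> exists u v, p = [set u; v]) -> (#|A| <= n * n)%N.
Proof.
move=> hA; rewrite -[n in (n * n)%N]card_ord -card_prod.
apply: leq_trans (leq_imset_card (fun q : 'I_n * 'I_n => [set q.1; q.2]) _).
apply: subset_leq_card; apply/subsetP => p /hA [u [v ->]].
by apply/imsetP; exists (u, v).
Qed.

(** [T j] is the number of pairs of [A] found inside a j-clique: 'C(j, 2) for edges, 0 for missing
    edges. Both population counts are shared by the three sizes; only the comparisons are
    repeated. *)
Lemma reach_clique (e : rel 'I_n) (k L : nat) (A : {set {set 'I_n}}) (T : nat -> nat) :
  (n <= 2 ^ L)%N -> (0 < k)%N ->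
  (forall p, p \in A -> exists u v, p = [set u; v]) ->
  (forall j x, is_clique e j x = (#|vertices x| == j) && (inside A x == T j)) ->
  exists2 gs, reach anyq (n + 2 * #|A| + a + 9 * L + 10) [::] gs &
    xspan anyq gs (fun z => (lpart z == zero_state 'I_a) &&
      [|| is_clique e k.-1 (rpart z), is_clique e k (rpart z) | is_clique e k.+1 (rpart z)]).
Proof.
move=> nL k0 hA hT; have [s sA] := pairs_of hA.
have sz_s : size s = #|A| by rewrite cardE sA size_map.
pose data (v : 'I_n) z := z (inr v).
have sF (gs : seq (basis ('I_a + 'I_n)%type -> bool)) t : xspans anyq gs [seq data v | v <- t].
  exact: xspans_inputs.
have [|g1 [b1 [r1 s1 z1 e1]]] := reach_popcount (L := L) _ (sF [::] (enum 'I_n)).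
  by rewrite size_map size_enum_ord.
have [|g2 r2 s2] := reach_map_and (sF g1 [seq q.1 | q <- s]) (sF g1 [seq q.2 | q <- s]).
  by rewrite !size_map.
have [|g3 [b3 [r3 s3 z3 e3]]] := reach_popcount (L := (2 * L)%N) _ s2.
  rewrite size_map size_zip !size_map minnn sz_s (leq_trans (card_pairs hA)) //.
  by rewrite mul2n -addnn expnD leq_mul.
have {}s1 := xspans_reach r3 (xspans_reach r2 s1).
(* The weight has L + 1 bits and the pair count 2 L + 1; with the AND joining both tests this is 3 L
   + 3 for each size. *)
have pat gs c : reach anyq c g3 gs -> forall j, exists2 hs, reach anyq (3 * L + 3) gs hs &
    xspan anyq hs (fun z => is_clique e j (rpart z)).
  move=> r j.
  have [h1 t1 u1] := reach_eq j (xspans_reach r s1).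
  have [h2 t2 u2] := reach_eq (T j) (xspans_reach t1 (xspans_reach r s3)).
  have [h3 t3 u3] := reach_and (xspan_reach t2 u1) u2.
  exists h3; first by apply: reach_le (reach_trans (reach_trans t1 t2) t3); rewrite z1 z3; lia.
  apply: xspan_ext u3 => z; rewrite hT e1 e3 card_vertices /inside sA; congr (_ && _).
    by rewrite !count_map; congr (_ == _); apply: eq_count => v; rewrite /= /rpart ffunE.
  congr (_ == _); rewrite count_map; elim: (s) => //= q t ->; congr (nat_of_bool _ + _)%N.
  by rewrite subUset !sub1set /vertices !inE !ffunE.
have [h1 t1 u1] := pat _ _ (reach0 _ _) k.-1.
have [h2 t2 u2] := pat _ _ t1 k.
have [h3 t3 u3] := pat _ _ (reach_trans t1 t2) k.+1.
have [h4 t4 u4] := reach_eq 0 (@xspans_inputs _ anyq h3 _ (@inl 'I_a 'I_n) (enum 'I_a) (fun=> isT)).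
have {}t4 : reach anyq a h3 h4 by move: t4; rewrite size_map -cardE card_ord.
have {}r1 : reach anyq n [::] g1 by move: r1; rewrite size_map size_enum_ord.
have {}r2 : reach anyq #|A| g1 g2 by move: r2; rewrite !size_map sz_s.
have {}r3 : reach anyq #|A| g2 g3.
  by move: r3; rewrite size_map size_zip !size_map minnn sz_s.
(* The three sizes differ because 0 < k, so the tests exclude each other and their disjunction is a
   free XOR. *)
have [h5 t5 u5] := reach_and u4 (xspan_reach t4 (xspan_xor
  (xspan_reach t3 (xspan_xor (xspan_reach t2 u1) u2)) u3)).
exists h5.
  apply: reach_le (reach_trans (reach_trans r1 (reach_trans r2 r3))
    (reach_trans (reach_trans (reach_trans t1 t2) t3) (reach_trans t4 t5))).
  by lia.
apply: xspan_ext u5 => z; congr (_ && _).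
  rewrite bval_eq0 all_map; apply/allP/eqP => [h|h v _].
    by apply/ffunP => v; rewrite !ffunE; apply/negbTE/h; rewrite mem_enum.
  by have /ffunP /(_ v) := h; rewrite /= !ffunE => ->.
rewrite /is_clique; case: eqP => [->|_].
  have /negPf -> : k.-1 != k by lia.
  have /negPf -> : k.-1 != k.+1 by lia.
  by rewrite /= !addbF !orbF.
case: eqP => [->|_] /=; last by [].
have /negPf -> : k != k.+1 by lia.
by rewrite /= addbF orbF.
Qed.

Lemma ent_flagged (B : 'M[C]_(dim 'I_n)) z' z : ent (flagged a B) z' z =
  (lpart z' == zero_state _)%:R * (lpart z == zero_state _)%:R * ent B (rpart z') (rpart z).
Proof.
rewrite ent_tensor; congr (_ * _).
rewrite /ent /proj0 mxE big_ord1 ketE 2!mxE.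
by have := ketE C (zero_state 'I_a) (lpart z); rewrite /ket => ->; rewrite rmorph_nat.
Qed.

Lemma ent_clique_proj (e : rel 'I_n) k y x : ent (clique_proj C e k) y x =
  [|| is_clique e k.-1 x, is_clique e k x | is_clique e k.+1 x]%:R * (y == x)%:R.
Proof.
rewrite ent_linmap; case: ifP => _; first by rewrite ketE mul1r.
by rewrite mxE mul0r.
Qed.

Lemma part_eq z z' : (z == z') = (lpart z == lpart z') && (rpart z == rpart z').
Proof.
apply/eqP/andP => [->|[/eqP /ffunP l /eqP /ffunP r]]; first by rewrite !eqxx.
by apply/ffunP => -[i|i]; [have := l i | have := r i]; rewrite !ffunE.
Qed.

(** i R = I - 2 P is a mere sign flip, so a phase circuit implements R up to the scalar that
    [implements] permits. *)
Lemma reflection_monomial (e : rel 'I_n) k :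
  monomial (fun z => (-1) ^+ ((lpart z == zero_state 'I_a) &&
      [|| is_clique e k.-1 (rpart z), is_clique e k (rpart z) | is_clique e k.+1 (rpart z)])) id
  = 'i *: reflection C a e k.
Proof.
apply: ent_inj => z' z; rewrite ent_monomial.
rewrite !entZ entD entN entZ ent_one ent_flagged ent_clique_proj.
rewrite mulrA imagC2 part_eq.
case: (lpart z =P zero_state _) => [->|_].
  case: eqP => _; last by rewrite /= !(mul0r, mulr0) subr0 mulr0.
  case: eqP => _; last by rewrite /= !(mul0r, mulr0) subr0 mulr0.
  case: [|| _, _ | _]; rewrite /= ?expr0 ?expr1 !(mulr1, mul1r, mulr0, mul0r); ring.
rewrite /= mulr0 mul0r mulr0 expr0 sub0r; ring.
Qed.

Lemma reflection_circuit (e : rel 'I_n) (k L : nat) (A : {set {set 'I_n}}) (T : nat -> nat) :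
  (n <= 2 ^ L)%N -> (0 < k)%N ->
  (forall p, p \in A -> exists u v, p = [set u; v]) ->
  (forall j x, is_clique e j x = (#|vertices x| == j) && (inside A x == T j)) ->
  exists w (c : circuit ('I_a + 'I_n + 'I_w)%type),
    (toffoli_count c <= 2 * (n + 2 * #|A| + a + 9 * L + 10))%N /\
    implements c (reflection C a e k).
Proof.
move=> nL k0 hA hT; have [gs [eg sg] xg] := reach_clique nL k0 hA hT.
have [gl [tof igl]] := impl_phase C eg (leqnn _) xg.
exists (size gs).+3, (circuit_of gl); split.
  by rewrite toffoli_circuit_of tof leq_mul2l sg.
move=> K; rewrite kraus_circuit_of inE => /eqP ->; exists 'i.
by rewrite igl reflection_monomial -scalemxAr.
Qed.

End Reflection.

(** * Registers as binary numbers, and sums over their values *)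

Section Registers.
Variables (C : numClosedFieldType) (Q : finType).
Implicit Types (l : seq Q) (x y z : basis Q).

Definition bits l : seq (basis Q -> bool) := [seq (fun z : basis Q => z q) | q <- l].
Definition nval l z := bval (bits l) z.

Lemma nval_eq l x z : {in l, x =1 z} -> nval l x = nval l z.
Proof.
rewrite /nval; elim: l => //= q l IH xz; rewrite xz ?mem_head // IH // => r rl.
by apply: xz; rewrite inE rl orbT.
Qed.

Lemma nval_set l z q b : q \notin l -> nval l (set_bit z q b) = nval l z.
Proof.
by move=> ql; apply: nval_eq => r rl; rewrite set_bitE; case: eqP rl ql => // -> ->.
Qed.

Lemma nval_eq0 l z : (nval l z == 0%N) = all (fun q => ~~ z q) l.
Proof. by rewrite /nval bval_eq0 all_map. Qed.

Lemma agree_nil x z : agree [::] x z = (x == z).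
Proof. by apply/agreeP/eqP => [h|->] //; apply/ffunP => q; apply: h. Qed.

Lemma sum_agree_cons q l x (F : basis Q -> C) : q \notin l ->
  \sum_(z | agree (q :: l) z x) F z
  = \sum_(z | agree l z (set_bit x q false)) F z
  + \sum_(z | agree l z (set_bit x q true)) F z.
Proof.
move=> ql; have hs b z : agree l z (set_bit x q b) = agree (q :: l) z x && (z q == b).
  apply/agreeP/andP => [h|[/agreeP h /eqP zq] r rl].
    split; last by rewrite h // set_bitE eqxx.
    apply/agreeP => r; rewrite inE negb_or => /andP [/negPf rq rl].
    by rewrite h // set_bitE rq.
  by rewrite set_bitE; case: eqP => [->|/eqP rq] //; rewrite h // inE negb_or rq.
rewrite (bigID (fun z => z q == false)) /=.
congr (_ + _); apply: eq_bigl => z; rewrite hs //.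
by case: (z q).
Qed.

Lemma sum_double N (F : nat -> C) :
  \sum_(i < N.*2) F i = \sum_(i < N) F i.*2 + \sum_(i < N) F i.*2.+1.
Proof.
elim: N => [|N IH]; first by rewrite !big_ord0 addr0.
by rewrite doubleS !big_ord_recr /= IH; ring.
Qed.

(** States agreeing with [x] outside two registers are parametrised by the register values. Fixing
    the lowest bit of a register splits its range into even and odd values, as in [sum_double]. *)
Lemma sum_agree l1 l2 x (F : nat -> nat -> C) : uniq (l1 ++ l2) ->
  \sum_(z | agree (l1 ++ l2) z x) F (nval l1 z) (nval l2 z)
  = \sum_(i < 2 ^ size l1) \sum_(j < 2 ^ size l2) F i j.
Proof.
elim: l1 x F => [|q l1 IH] x F /=.
  move=> ul; rewrite big_ord1 /= {1}/nval /=; move: (F 0%N) => {}F.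
  elim: l2 x F ul => [|q l2 IH] x F /=.
    move=> _; rewrite big_ord1 (big_pred1 x) => [|z]; last by rewrite agree_nil.
    by [].
  case/andP=> ql ul; rewrite sum_agree_cons // expnS mul2n sum_double.
  rewrite -(IH (set_bit x q false) (fun j => F j.*2)) //.
  rewrite -(IH (set_bit x q true) (fun j => F j.*2.+1)) //.
  congr (_ + _); apply: eq_bigr => z /agreeP az;
    by rewrite /nval /= az // set_bitE eqxx.
case/andP=> ql ul; rewrite sum_agree_cons // expnS mul2n.
rewrite (sum_double _ (fun i => \sum_(j < 2 ^ size l2) F i j)).
rewrite -(IH (set_bit x q false) (fun i j => F i.*2 j)) //.
rewrite -(IH (set_bit x q true) (fun i j => F i.*2.+1 j)) //.
congr (_ + _); apply: eq_bigr => z /agreeP az; by rewrite /nval /= az // set_bitE eqxx.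
Qed.

Lemma sum_lt_ord N c : (c <= N)%N -> \sum_(i < N) (i < c)%N%:R = c%:R :> C.
Proof.
move=> cN; rewrite -natr_sum; congr (_%:R).
elim: N c cN => [|N IH] c cN; first by rewrite big_ord0; case: c cN.
move: cN; rewrite leq_eqVlt => /predU1P [->|cN].
  rewrite (eq_bigr (fun=> 1%N)) => [|i _]; last by rewrite ltn_ord.
  by rewrite sum1_card card_ord.
by rewrite big_ord_recr /= IH // ltnNge -ltnS cN addn0.
Qed.

Lemma sum_eq_ord N c : (c < N)%N -> \sum_(i < N) (nat_of_ord i == c)%:R = 1 :> C.
Proof.
move=> cN; rewrite (bigD1 (Ordinal cN)) //= eqxx big1 ?addr0 // => i ic.
by move/negPf: ic; rewrite -val_eqE /= => ->.
Qed.

End Registers.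

(** * Linear combination of unitaries with one round of amplitude amplification *)

Section LinearCombination.
Variables (C : numClosedFieldType) (A : finType) (n : nat).
Local Notation Q := (A + 'I_n)%type.
(** [L1] holds the index v, [L2] the padding value y, and [fl] flags bad branches. The threshold [t]
    tunes the fraction n t / 2^M of good register values. *)
Variables (L1 L2 : seq Q) (fl : Q) (t : nat).
Hypotheses (uniqL : uniq (fl :: L1 ++ L2)) (dataL : forall v : 'I_n, inr v \notin fl :: L1 ++ L2).
Hypotheses (nL : (n <= 2 ^ size L1)%N) (tL : (t <= 2 ^ size L2)%N).
Implicit Types (x y z : basis Q) (u v : 'I_n).

Local Notation L := (L1 ++ L2).
Local Notation M := (size L).

Definition hnorm : C := (sqrtC 2)^-1 ^+ M.

Lemma uniq_reg : uniq L.
Proof. by case/andP: uniqL. Qed.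

Lemma flag_reg : fl \notin L.
Proof. by case/andP: uniqL. Qed.

Lemma data_reg v : inr v \notin L.
Proof. by have := dataL v; rewrite inE negb_or => /andP []. Qed.

Lemma hnorm_sqr : hnorm * hnorm = (2 ^ M)%:R^-1.
Proof. by rewrite -exprMn r2_sqr exprVn natrX. Qed.

Lemma hnorm_real : hnorm^* = hnorm.
Proof. by rewrite rmorphXn /= r2_real. Qed.

Definition phase (f : basis Q -> bool) : 'M[C]_(dim Q) := monomial (fun z => (-1) ^+ f z) id.

Lemma ent_phase_mul f (B : 'M[C]_(dim Q)) y x :
  ent (phase f *m B) y x = (-1) ^+ f y * ent B y x.
Proof.
rewrite ent_mul (bigD1 y) //= big1 => [|z zy]; rewrite ent_monomial.
  by rewrite eqxx mulr1 addr0.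
by rewrite eq_sym (negPf zy) mulr0 mul0r.
Qed.

Lemma phase_herm f : (phase f)^t* = phase f.
Proof.
apply: ent_inj => y x; rewrite ent_adj !ent_monomial rmorphM rmorph_nat /= signb_real.
by rewrite eq_sym; case: eqP => [->|_] //; rewrite !mulr0.
Qed.

Definition good z := (nval L1 z < n)%N && (nval L2 z < t)%N.
Definition blank z := all (fun q => ~~ z q) L.

(* One round of amplitude amplification of the good basis states. *)
Definition amplify : 'M[C]_(dim Q) :=
  hadl C L *m phase (fun z => nval L z == 0%N) *m hadl C L *m phase good *m hadl C L.

Lemma ent_had_blank y x : blank x -> ent (hadl C L) y x = hnorm * (agree L y x)%:R.
Proof.
move=> /allP bx; rewrite ent_hadl ?uniq_reg // /hsign big_seq big1 ?mulr1 // => q ql.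
by rewrite (negPf (bx q ql)) andbF expr0.
Qed.

Lemma ent_blank_had y x : blank y -> ent (hadl C L) y x = hnorm * (agree L y x)%:R.
Proof.
move=> bly; rewrite -hadl_herm ?uniq_reg // ent_adj ent_had_blank // rmorphM rmorph_nat /=.
by rewrite hnorm_real agree_sym.
Qed.

(** The Grover diffusion I - 2 |s><s|, with s uniform on the registers: the sign changes only the
    blank intermediate state, and the rest is the square of the Hadamard layer. *)
Lemma ent_diffusion y x :
  ent (hadl C L *m phase (fun z => nval L z == 0%N) *m hadl C L) y x
  = (y == x)%:R - 2 * (hnorm * hnorm) * (agree L y x)%:R.
Proof.
rewrite -mulmxA ent_mul.
under eq_bigr => z _ do rewrite ent_phase_mul nval_eq0 -/(blank z).
have split_z z : ent (hadl C L) y z * ((-1) ^+ blank z * ent (hadl C L) z x)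
    = ent (hadl C L) y z * ent (hadl C L) z x
      - 2 * (hnorm * hnorm) * (blank z && agree L y z && agree L z x)%:R.
  case bz: (blank z); last by rewrite mulr0 subr0 expr0 mul1r.
  rewrite ent_had_blank // ent_blank_had // expr1 /=.
  by move: hnorm => h; case: (agree L y z); case: (agree L z x); rewrite /= ?mulr1n ?mulr0n; ring.
under eq_bigr => z _ do rewrite split_z.
rewrite sumrB -ent_mul hadlK ?uniq_reg // ent_one -mulr_sumr; congr (_ - _ * _).
(* The only blank state that agrees with [y] outside the registers. *)
pose y0 : basis Q := [ffun q => (q \notin L) && y q].
have y0y : agree L y y0 by apply/agreeP => q ql; rewrite ffunE ql.
rewrite (bigD1 y0) //= big1 => [|z zy0].
  have -> : blank y0 by apply/allP => q ql; rewrite ffunE ql.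
  rewrite addr0 y0y /=; congr (_%:R); congr nat_of_bool.
  apply/idP/idP; first exact: agree_trans.
  by move=> yx; apply: agree_trans yx; rewrite agree_sym.
case: andP => // -[/andP [/allP bz /agreeP yz] _].
case/eqP: zy0; apply/ffunP => q; rewrite ffunE; case: (boolP (q \in L)) => ql /=.
  by apply/negbTE/bz.
by rewrite yz.
Qed.

Lemma sum_good_sign x :
  \sum_(z | agree L z x) (-1) ^+ good z = (2 ^ M)%:R - 2 * (n * t)%:R :> C.
Proof.
have sgn_b (b c : bool) : (-1 : C) ^+ (b && c) = 1 - 2 * (b%:R * c%:R).
  by case: b; case: c; rewrite /= ?expr0 ?expr1 ?mulr1n ?mulr0n; ring.
rewrite (sum_agree x (fun i j => (-1) ^+ ((i < n) && (j < t))%N)) ?uniq_reg //.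
under eq_bigr => i _.
  under eq_bigr => j _ do rewrite sgn_b.
  rewrite sumrB -mulr_sumr -mulr_sumr sum_lt_ord // sumr_const card_ord.
  over.
rewrite sumrB -mulr_sumr -mulr_suml sum_lt_ord // sumr_const card_ord.
by rewrite -mulrnA -natrM -expnD size_cat addnC.
Qed.

(** The sign-flipped uniform amplitude minus twice its mean; it depends on [z] only through
    [good z]. *)
Definition amp z : C := hnorm * ((-1) ^+ good z - 2 * (hnorm * hnorm) * ((2 ^ M)%:R - 2 * (n * t)%:R)).

Lemma ent_amplify y x : blank x -> ent amplify y x = (agree L y x)%:R * amp y.
Proof.
move=> bx; rewrite /amplify -mulmxA ent_mul.
under eq_bigr => z _ do rewrite ent_diffusion ent_phase_mul ent_had_blank //.
under eq_bigr => z _ do rewrite mulrBl.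
rewrite sumrB (bigD1 y) //= big1 => [|z zy]; last by rewrite eq_sym (negPf zy) mul0r.
rewrite addr0 eqxx mul1r.
have -> : \sum_i 2 * (hnorm * hnorm) * (agree L y i)%:R * ((-1) ^+ good i * (hnorm * (agree L i x)%:R))
   = (agree L y x)%:R * (2 * (hnorm * hnorm) * hnorm) * \sum_(z | agree L z x) (-1) ^+ good z.
  rewrite [in RHS]big_mkcond mulr_sumr; apply: eq_bigr => z _.
  case zx: (agree L z x); last by rewrite !mulr0.
  have -> : agree L y z = agree L y x.
    apply/idP/idP => h; first exact: agree_trans h zx.
    by apply: agree_trans h _; rewrite agree_sym.
  by rewrite mulr1n; move: ((agree L y x)%:R : C) ((-1) ^+ good z : C) hnorm => p s h; ring.
rewrite sum_good_sign /amp.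
move: ((2 ^ M)%:R - _ : C) ((agree L y x)%:R : C) ((-1) ^+ good y : C) hnorm => N p s h; ring.
Qed.

Definition delta v z := (nval L2 z < t)%N && (nval L1 z == v).
Definition flip v z : basis Q := set_bit z (inr v) (~~ z (inr v)).
Definition sgn v z : C := \prod_(u < n | (u < v)%N) (-1) ^+ z (inr u).

(** Under the Jordan-Wigner transformation Z_(<v) X_v is a Majorana operator; here [delta v]
    controls it. *)
Definition majorana_if v : 'M[C]_(dim Q) :=
  monomial (fun z => if delta v z then sgn v z else 1)
           (fun z => if delta v z then flip v z else z).

(** The constant coefficient is spelled as a conditional to match the shape produced by
    [midimpl_ctrl]. *)
Definition raise_flag : 'M[C]_(dim Q) :=
  monomial (fun z => if ~~ good z then 1 else 1)
           (fun z => if ~~ good z then set_bit z fl (~~ z fl) else z).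

Definition majoranas (vs : seq 'I_n) := foldr (fun v B => B *m majorana_if v) 1%:M vs.
(* Flipping the flag when the index is bad removes that branch from <0|_|0>. *)
Definition select := raise_flag *m majoranas (enum 'I_n).

Lemma L1_sub q : q \notin L -> q \notin L1.
Proof. by rewrite mem_cat negb_or => /andP []. Qed.

Lemma L2_sub q : q \notin L -> q \notin L2.
Proof. by rewrite mem_cat negb_or => /andP []. Qed.

Lemma delta_set v z q b : q \notin L -> delta v (set_bit z q b) = delta v z.
Proof. by move=> qL; rewrite /delta !nval_set ?L1_sub ?L2_sub. Qed.

Lemma good_set z q b : q \notin L -> good (set_bit z q b) = good z.
Proof. by move=> qL; rewrite /good !nval_set ?L1_sub ?L2_sub. Qed.

Lemma majoranas_id vs z : (forall v, v \in vs -> ~~ delta v z) ->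
  majoranas vs *m ket C z = ket C z.
Proof.
elim: vs => [|v vs IH] hz /=; first by rewrite mul1mx.
rewrite -mulmxA linmap_ket (negPf (hz v _)) ?mem_head // scale1r IH // => u uvs.
by apply: hz; rewrite inE uvs orbT.
Qed.

Lemma delta_inj u v z : delta v z -> delta u z -> u = v.
Proof. by move=> /andP [_ /eqP zv] /andP [_ /eqP zu]; apply/val_inj; rewrite /= -zv. Qed.

(** At most one indicator holds at [z], and flipping a vertex qubit changes none of them, so exactly
    one factor acts. *)
Lemma majoranas_flip vs v z : uniq vs -> v \in vs -> delta v z ->
  majoranas vs *m ket C z = sgn v z *: ket C (flip v z).
Proof.
elim: vs => // u vs IH /= /andP [+ uv]; rewrite inE -mulmxA linmap_ket.
case: eqP => [<-|/eqP vu] /= uvs vvs dz.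
  rewrite dz -scalemxAr majoranas_id // => w wvs; rewrite delta_set ?data_reg //.
  by apply: contra uvs => /(delta_inj dz) <-.
case: ifP => [/(delta_inj dz) /eqP|_]; first by rewrite eq_sym (negPf vu).
by rewrite scale1r IH.
Qed.

Lemma goodP z : reflect (exists v, delta v z) (good z).
Proof.
apply: (iffP andP) => [[zn zt]|[v /andP [zt /eqP zv]]]; last by rewrite zv zt ltn_ord.
by exists (Ordinal zn); rewrite /delta zt /=.
Qed.

Lemma select_bad z : ~~ good z -> select *m ket C z = ket C (set_bit z fl (~~ z fl)).
Proof.
move=> bz; rewrite -mulmxA majoranas_id => [|v _].
  by rewrite linmap_ket bz scale1r.
by apply: contra bz => dz; apply/goodP; exists v.
Qed.

Lemma select_good v z : delta v z -> select *m ket C z = sgn v z *: ket C (flip v z).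
Proof.
move=> dz; rewrite -mulmxA (majoranas_flip _ _ dz) ?enum_uniq ?mem_enum //.
rewrite -scalemxAr linmap_ket good_set ?data_reg //.
have -> : good z by apply/goodP; exists v.
by rewrite /= scale1r.
Qed.

Definition lcu := amplify^t* *m select *m amplify.

(** The value of [amp] on good states; with alpha = n t / 2^M it equals - hnorm (3 - 4 alpha). *)
Definition amp1 : C := hnorm * (-1 - 2 * (hnorm * hnorm) * ((2 ^ M)%:R - 2 * (n * t)%:R)).

Lemma amp1_real : amp1^* = amp1.
Proof. by rewrite /amp1 !(rmorphM, rmorphB, rmorphN, rmorph1, rmorph_nat) /= hnorm_real. Qed.

Lemma sum_delta v x : \sum_(z | agree L z x) (delta v z)%:R = t%:R :> C.
Proof.
rewrite (sum_agree x (fun i j => ((j < t) && (i == v))%N%:R)) ?uniq_reg //.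
under eq_bigr => i _.
  under eq_bigr => j _ do rewrite -mulnb natrM.
  rewrite -mulr_suml sum_lt_ord //.
  over.
by rewrite -mulr_sumr sum_eq_ord ?mulr1 // (leq_trans (ltn_ord v)).
Qed.

(** Between states with zero ancillas only good register values survive. Each v has [t] of them, all
    entering and leaving with the same real amplitude [amp1], and [select] supplies the entry of
    Z_(<v) X_v. *)
Lemma ent_lcu y x : (forall q : A, ~~ y (inl q)) -> (forall q : A, ~~ x (inl q)) ->
  ent lcu y x = t%:R * (amp1 * amp1) * \sum_v sgn v x * (y == flip v x)%:R.
Proof.
move=> y0 x0.
have in_inl q : q \in fl :: L -> exists q', q = inl q'.
  by case: q => [q' _|v qv]; [exists q' | have := dataL v; rewrite qv].
have blank0 z : (forall q : A, ~~ z (inl q)) -> blank z.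
  move=> z0; apply/allP => q qL; have [|q' ->] := in_inl q; last exact: z0.
  by rewrite inE qL orbT.
have yfl : y fl = false by have [|q ->] := in_inl fl; [rewrite mem_head | apply/negbTE/y0].
have xfl : x fl = false by have [|q ->] := in_inl fl; [rewrite mem_head | apply/negbTE/x0].
have term z : ent (amplify^t* *m select) y z * ent amplify z x =
    \sum_v (agree L z x && delta v z)%:R * (amp1 * amp1 * (sgn v x * (y == flip v x)%:R)).
  rewrite (ent_amplify _ (blank0 _ x0)); case zx: (agree L z x); last first.
    by rewrite mul0r mulr0 big1 // => v _; rewrite mul0r.
  rewrite mulr1n mul1r /=; case: (boolP (good z)) => [/goodP [v dz]|bz]; last first.
    rewrite big1 => [|v _]; last first.
      by case: (boolP (delta v z)) => [dz|_]; [case/goodP: bz; exists v | rewrite mul0r].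
    (* A bad branch leaves the flag raised, and the final factor, acting only on [L1 ++ L2], cannot
       lower it. *)
    rewrite -mul_ket -mulmxA select_bad // mul_ket ent_adj (ent_amplify _ (blank0 _ y0)).
    suff /negPf -> : ~~ agree L (set_bit z fl (~~ z fl)) y by rewrite mul0r conjC0 mul0r.
    apply/negP => /agreeP /(_ _ flag_reg); rewrite set_bitE eqxx yfl.
    by rewrite (agreeP _ _ _ zx) ?flag_reg // xfl.
  rewrite (bigD1 v) //= big1 => [|u uv]; last first.
    by case: (boolP (delta u z)) => [/(delta_inj dz) /eqP|_]; rewrite ?(negPf uv) ?mul0r.
  rewrite addr0 dz mulr1n mul1r -mul_ket -mulmxA (select_good dz) -scalemxAr mxE mul_ket.
  rewrite ent_adj (ent_amplify _ (blank0 _ y0)).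
  have gz : good z by apply/goodP; exists v.
  have -> : amp (flip v z) = amp1 by rewrite /amp good_set ?data_reg // gz.
  have -> : amp z = amp1 by rewrite /amp gz.
  have -> : sgn v z = sgn v x.
    by apply: eq_bigr => u _; rewrite (agreeP _ _ _ zx) ?data_reg.
  have -> : agree L (flip v z) y = (y == flip v x).
    apply/agreeP/eqP => [h|-> q qL]; last first.
      rewrite !set_bitE; case: eqP => [_|_]; last exact: (agreeP _ _ _ zx).
      by rewrite (agreeP _ _ _ zx) ?data_reg.
    apply/ffunP => -[q|u]; rewrite set_bitE /=.
      by rewrite (negPf (y0 q)) (negPf (x0 q)).
    by rewrite -h ?data_reg // set_bitE !(agreeP _ _ _ zx) ?data_reg.
  rewrite rmorphM rmorph_nat /= amp1_real.
  move: amp1 (sgn v x) ((y == flip v x)%:R : C) => h s p; ring.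
rewrite /lcu ent_mul; under eq_bigr => z _ do rewrite term.
rewrite exchange_big /= mulr_sumr; apply: eq_bigr => v _; rewrite -mulr_suml.
have -> : \sum_(z : basis Q) (agree L z x && delta v z)%:R = t%:R :> C.
  rewrite -(sum_delta v x) [RHS]big_mkcond; apply: eq_bigr => z _.
  by case: (agree L z x).
by rewrite !mulrA.
Qed.

(** Hadamard layers and sign flips are Hermitian, so the adjoint of [amplify] is the same gates in
    reverse order. *)
Lemma lcuE : lcu = hadl C L *m phase good *m hadl C L *m phase (fun z => nval L z == 0%N)
  *m hadl C L *m select *m amplify.
Proof.
rewrite /lcu /amplify !trmx_mul !map_mxM /= !hadl_herm ?uniq_reg // !phase_herm.
by rewrite !mulmxA.
Qed.

Local Notation I := [pred q : Q | q \in L].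

Lemma xspans_reg (l : seq Q) gs : {subset l <= L} -> xspans I gs (bits l).
Proof.
elim: l => [|q l IH] ll; first exact: xspans_nil.
apply: xspansI; first by apply: xspan_input; apply: ll; rewrite mem_head.
by apply: IH => p pl; apply: ll; rewrite inE pl orbT.
Qed.

Lemma L1_reg : {subset L1 <= L}. Proof. by move=> q; rewrite mem_cat => ->. Qed.
Lemma L2_reg : {subset L2 <= L}. Proof. by move=> q; rewrite mem_cat orbC => ->. Qed.

Lemma reach_good gs : exists2 hs, reach I (M + 1) gs hs & xspan I hs good.
Proof.
have [h1 r1 u1] := reach_lt n (xspans_reg gs L1_reg).
have [h2 r2 u2] := reach_lt t (xspans_reg h1 L2_reg).
have [h3 r3 u3] := reach_and (xspan_reach r2 u1) u2.
exists h3 => //; apply: reach_le (reach_trans r1 (reach_trans r2 r3)).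
by rewrite !size_map size_cat addnA.
Qed.

(** The test y < t is the root of the decoding tree, so attaching it to every indicator costs
    nothing. *)
Lemma reach_deltas gs :
  exists2 hs, reach I (n + M) gs hs & forall v, xspan I hs (delta v).
Proof.
have [h1 r1 u1] := reach_lt t (xspans_reg gs L2_reg).
have [h2 r2 u2] := reach_decode n (xspans_reg h1 L1_reg) u1.
exists h2 => [|v]; last exact: u2.
by apply: reach_le (reach_trans r1 r2); rewrite !size_map size_cat addnCA leq_add2l addnC.
Qed.

Section Circuit.
Variable d : nat.
Local Notation W := (Q + 'I_d.+3)%type.

(** The programs read only register qubits, so flipping the flag or a vertex qubit leaves the stored
    products correct. *)
Lemma gs_local gs q b : ext I [::] gs -> q \notin L ->
  forall x i, nthf gs i (set_bit x q b) = nthf gs i x.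
Proof.
move=> egs qL x i; apply: (xspan_local egs (xspan_gate I gs i)) => p /= pL.
by rewrite set_bitE; case: eqP pL qL => // -> ->.
Qed.

Lemma cz_chain gs (us : seq 'I_n) : exists cg : seq (gate W), count (@is_toffoli _) cg = 0%N /\
  forall x b, run C cg *m ket C (layout d gs x b false)
    = (\prod_(u <- us) (-1) ^+ (b && x (inr u))) *: ket C (layout d gs x b false).
Proof.
elim: us => [|u us [cg [cg0 hcg]]].
  by exists [::]; split=> // x b; rewrite big_nil scale1r /= mul1mx.
have su : scr1 Q d != inl (inr u) by [].
have [cz [cz0 hcz]] := cz_gate C su.
exists (cz ++ cg); split; first by rewrite count_cat cz0 cg0.
move=> x b; rewrite run_cat -mulmxA hcz -scalemxAr hcg scalerA big_cons.
by congr (_ * _ *: _); rewrite !ffunE.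
Qed.

(** With the indicator on a scratch wire, the controlled operator is a controlled Z to every u < v
    followed by one CNOT to v. *)
Lemma majorana_mid gs v : ext I [::] gs -> (size gs <= d)%N -> xspan I gs (delta v) ->
  exists cg : seq (gate W), count (@is_toffoli _) cg = 0%N /\ midimpl gs cg (majorana_if v).
Proof.
move=> egs le_d sd; have [cz [cz0 hcz]] := cz_chain gs [seq u : 'I_n <- enum 'I_n | (u < v)%N].
have sv : scr1 Q d != inl (inr v) by [].
apply: (midimpl_ctrl (cg := cz ++ [:: CNOT sv]) sd le_d).
- by rewrite count_cat cz0.
- by move=> x; rewrite delta_set ?data_reg.
move=> x b; rewrite run_cat -mulmxA hcz -scalemxAr /= mul1mx linmap_ket.
rewrite layout_set; last by move=> i; apply: gs_local => //; apply: data_reg.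
rewrite !ffunE /= big_filter big_enum_cond /=; case: b; last first.
  by rewrite big1 // addbF set_bit_id.
by rewrite addbT.
Qed.

Lemma raise_flag_mid gs : ext I [::] gs -> (size gs <= d)%N -> xspan I gs good ->
  exists cg : seq (gate W), count (@is_toffoli _) cg = 0%N /\ midimpl gs cg raise_flag.
Proof.
move=> egs le_d sg.
have sv : scr1 Q d != inl fl by [].
apply: (midimpl_ctrl (cg := [:: CNOT sv]) (xspan_neg sg) le_d) => //.
- by move=> x; rewrite good_set ?flag_reg.
move=> x b; rewrite /= mul1mx linmap_ket.
rewrite layout_set; last by move=> i; apply: gs_local => //; apply: flag_reg.
by rewrite !ffunE /=; case: b; rewrite ?addbT ?addbF ?set_bit_id scale1r.
Qed.

(** The indicators (n + M ANDs) and [good] (M + 1 ANDs) are computed once, serve all the controlled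
    operators, and are then uncomputed. *)
Lemma select_impl : (n + 2 * M + 1 <= d)%N -> exists gl : seq (gate W),
  (count (@is_toffoli _) gl <= 2 * (n + 2 * M + 1))%N /\ impl gl select.
Proof.
move=> le_d; have [h1 r1 u1] := reach_deltas [::]; have [h2 r2 u2] := reach_good h1.
have [egs sz] := reach_trans r1 r2.
have {}sz : (size h2 <= n + 2 * M + 1)%N by apply: leq_trans sz _; rewrite add0n; lia.
have sd := leq_trans sz le_d.
have [cm [cm0 mm]] : exists cg : seq (gate W), count (@is_toffoli _) cg = 0%N /\
    midimpl h2 cg (majoranas (enum 'I_n)).
  elim: (enum 'I_n) => [|v vs [cg [cg0 mcg]]].
    by exists [::]; split=> //; rewrite /midimpl /= mul1mx mulmx1.
  have [cv [cv0 mcv]] := majorana_mid egs sd (xspan_reach r2 (u1 v)).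
  exists (cv ++ cg); split; first by rewrite count_cat cv0 cg0.
  exact: midimpl_cat mcv mcg.
have [cf [cf0 mf]] := raise_flag_mid egs sd u2.
have [gl [tof igl]] := impl_sandwich egs sd (midimpl_cat mm mf).
exists gl; split=> //; rewrite tof count_cat cm0 cf0; lia.
Qed.

Lemma phase_good_impl : (M + 1 <= d)%N -> exists gl : seq (gate W),
  (count (@is_toffoli _) gl <= 2 * (M + 1))%N /\ impl gl (phase good).
Proof.
move=> le_d; have [h1 [e1 s1] u1] := reach_good [::].
have [gl [tof igl]] := impl_phase C e1 (leq_trans s1 le_d) u1.
by exists gl; split=> //; rewrite tof leq_mul2l.
Qed.

Lemma phase_zero_impl : (M <= d)%N -> exists gl : seq (gate W),
  (count (@is_toffoli _) gl <= 2 * M)%N /\ impl gl (phase (fun z => nval L z == 0%N)).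
Proof.
move=> le_d; have [//|h1 [e1 s1] u1] := reach_eq 0 (@xspans_reg L [::] _).
move: s1; rewrite add0n size_map => s1.
have [gl [tof igl]] := impl_phase C e1 (leq_trans s1 le_d) u1.
by exists gl; split=> //; rewrite tof leq_mul2l.
Qed.

(** [select] costs 2 n + 4 M + 2; each of the two amplifications adds 2 M + 2 for the good states
    and 2 M for the diffusion. *)
Lemma lcu_impl : (n + 2 * M + 1 <= d)%N -> exists gl : seq (gate W),
  (count (@is_toffoli _) gl <= 2 * n + 12 * M + 6)%N /\ impl gl lcu.
Proof.
move=> le_d; have [gs [ts iss]] := select_impl le_d.
have [|gg [tg ig]] := phase_good_impl; first by lia.
have [|g0 [t0 i0]] := phase_zero_impl; first by lia.
have ih := impl_hadl C d.+3 L; move: ih; set gh := map _ L => ih.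
have th : count (@is_toffoli _) gh = 0%N by rewrite /gh; elim: (L) => //=.
exists ((gh ++ gg ++ gh ++ g0 ++ gh) ++ gs ++ (gh ++ g0 ++ gh ++ gg ++ gh)); split.
  by rewrite !count_cat th; lia.
(* [select] is itself a product; generalising it keeps it a single factor during reassociation. *)
rewrite lcuE /amplify; move: select iss => sel iss; rewrite -!mulmxA !catA; by do 10!apply: impl_cat => //.
Qed.

End Circuit.
End LinearCombination.

(** * Entries of the Dirac operator as a compressed sum of Majorana operators *)

Section DiracEntries.
Variables (C : numClosedFieldType) (n : nat) (e : rel 'I_n).
Implicit Types (x y : basis 'I_n) (u v w : 'I_n).

Definition before v x := #|[set u : 'I_n | x u && (u < v)%N]|.

Lemma before_lt u v x : (u < v)%N -> x u -> (before u x < before v x)%N.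
Proof.
move=> uv xu; apply: proper_card; apply/properP; split.
  by apply/subsetP => w; rewrite !inE => /andP [-> /ltn_trans]; apply.
by exists u; rewrite !inE xu ?ltnn.
Qed.

Lemma before_inj x : {in [pred v | x v] &, injective (before^~ x)}.
Proof.
move=> u v; rewrite !inE => xu xv eq_uv; apply/val_inj.
by case: (ltngtP u v) => // [/before_lt|/before_lt] /(_ x); rewrite eq_uv ltnn => /(_ _) h;
  have := h ltac:(assumption).
Qed.

Lemma before_bound v x : x v -> (before v x < #|vertices x|)%N.
Proof.
move=> xv; apply: proper_card; apply/properP; split.
  by apply/subsetP => w; rewrite !inE => /andP [].
by exists v; rewrite !inE ?ltnn ?andbF.
Qed.

(** Translates the position of a one, which indexes the boundary map, into a vertex. *)
Lemma delete_before v x : x v -> delete_one x (before v x) = set_bit x v false.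
Proof.
move=> xv; apply/ffunP => w; rewrite !ffunE; have [->|wv] := eqVneq w v.
  by rewrite eqxx andbF.
case xw: (x w) => //=; apply: contra wv => /eqP h; apply/eqP.
by apply: (@before_inj x) => //; rewrite inE.
Qed.

(* The part of sum_v Z_(<v) X_v that lowers the Hamming weight. *)
Definition lower y x : C :=
  \sum_(v | x v) (-1) ^+ before v x * (y == set_bit x v false)%:R.

(** [before] sends the ones of [x] injectively, hence by counting bijectively, onto the positions
    below [j]. *)
Lemma sum_before j x (F : nat -> C) : #|vertices x| = j ->
  \sum_(i < j) F i = \sum_(v | x v) F (before v x).
Proof.
case: j => [|j] xj.
  rewrite big_ord0 big1 // => v xv; have /cards0_eq /setP /(_ v) := xj.
  by rewrite !inE xv.
pose h v : 'I_j.+1 := inord (before v x).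
have hE v : x v -> h v = before v x :> nat by move=> xv; rewrite inordK // -xj before_bound.
have h_inj : {in vertices x &, injective h}.
  move=> u v; rewrite !inE => xu xv huv; apply: (@before_inj x) => //.
  by rewrite -!hE // huv.
have full : h @: vertices x = [set: 'I_j.+1].
  by apply/eqP; rewrite eqEcard subsetT cardsT card_ord card_in_imset // xj /=.
rewrite (eq_bigl (mem (h @: vertices x))) => [|i]; last by rewrite full !inE.
rewrite big_imset //=; apply: eq_big => [v|v]; rewrite inE // => xv.
by rewrite hE.
Qed.

Lemma ent_boundary j y x :
  ent (boundary C e j) y x = (is_clique e j.+1 x)%:R * lower y x.
Proof.
rewrite ent_linmap; case: ifP => [/andP [/eqP xj _]|_]; last by rewrite mxE mul0r.
rewrite mul1r summxE.
rewrite (eq_bigr (fun i : 'I_j.+1 => (-1) ^+ i * (y == delete_one x i)%:R)) => [|i _].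
  rewrite (sum_before (fun i => (-1) ^+ i * (y == delete_one x i)%:R) xj).
  by apply: eq_bigr => v xv; rewrite delete_before.
by rewrite mxE ketE.
Qed.

Definition near_clique k x := [|| is_clique e k.-1 x, is_clique e k x | is_clique e k.+1 x].

(** Removing a vertex from a clique leaves a clique, so the condition on both states only forces [x]
    to be a clique of size k or k + 1. The sum of the two cases matches the two boundary maps in
    [dirac]. *)
Lemma clique_lower k v x : (0 < k)%N -> x v ->
  (near_clique k (set_bit x v false) && near_clique k x : nat)
  = (is_clique e k x + is_clique e k.+1 x)%N.
Proof.
move=> k0 xv; rewrite /near_clique /is_clique.
set V := vertices x; set V' := vertices (set_bit x v false).
have VV' : V' = V :\ v.
  by apply/setP => u; rewrite !inE ffunE; case: eqP => [->|].
have cV : #|V| = #|V'|.+1 by rewrite (cardsD1 v V) inE xv VV'.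
set q := [forall u in V, _]; set q' := [forall u in V', _].
have qq' : q -> q'.
  move=> /forall_inP h; apply/forall_inP => u; rewrite VV' !inE => /andP [_ xu].
  apply/forall_inP => w; rewrite !inE => /andP [_ xw].
  by have /forall_inP := h u ltac:(by rewrite inE); apply; rewrite inE.
rewrite cV; move: #|V'| => c.
case: q qq' => [/(_ isT) ->|_]; last by rewrite !andbF /= ?andbF.
by rewrite !andbT; lia.
Qed.

Definition raise y x : C :=
  \sum_(v | ~~ x v) (-1) ^+ before v x * (y == set_bit x v true)%:R.

(** Flipping [v] does not change the ones before [v], so the part of the sum that raises the weight
    is the transpose of the part that lowers it. *)
Lemma raise_lower y x : raise y x = lower x y.
Proof.
rewrite /raise /lower big_mkcond [RHS]big_mkcond; apply: eq_bigr => v _.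
have [yx|yx] := eqVneq y (set_bit x v true).
  rewrite yx set_bitE eqxx set_bit_set.
  have -> : before v (set_bit x v true) = before v x.
    by apply: eq_card => u; rewrite !inE ffunE; case: (u =P v) => // ->; rewrite ltnn !andbF.
  case xv: (x v); last by have -> : set_bit x v false = x by [rewrite -xv set_bit_id]; rewrite !eqxx.
  suff /negPf -> : x != set_bit x v false by rewrite mulr0.
  by apply/eqP => /ffunP /(_ v); rewrite set_bitE eqxx xv.
rewrite mulr0; case yv: (y v); last by case: (~~ _).
suff /negPf -> : x != set_bit y v false by rewrite mulr0; case: (~~ _).
by apply: contraNN yx => /eqP ->; rewrite set_bit_set -yv set_bit_id.
Qed.

Lemma lower_real y x : (lower y x)^* = lower y x.
Proof.
rewrite rmorph_sum; apply: eq_bigr => v _.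
by rewrite rmorphM rmorphXn rmorphN1 rmorph_nat.
Qed.

Lemma lower_clique k y x : (0 < k)%N ->
  (near_clique k y && near_clique k x)%:R * lower y x
  = (is_clique e k x + is_clique e k.+1 x)%:R * lower y x.
Proof.
move=> k0; rewrite /lower !mulr_sumr; apply: eq_bigr => v xv.
case: eqP => [->|_]; last by rewrite !mulr0.
by rewrite clique_lower.
Qed.

(** Cut down to the three clique spaces, the lowering part yields the two boundary maps and the
    raising part their adjoints, the entries being real. *)
Lemma ent_dirac k y x : (0 < k)%N -> ent (dirac C e k) y x
  = (near_clique k y && near_clique k x)%:R *
    \sum_v (-1) ^+ before v x * (y == set_bit x v (~~ x v))%:R.
Proof.
move=> k0; rewrite (bigID (fun v => x v)) /=.
rewrite (eq_bigr (fun v => (-1) ^+ before v x * (y == set_bit x v false)%:R)); last first.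
  by move=> v ->.
rewrite -/(lower y x) [X in _ + X](_ : _ = raise y x); last first.
  by apply: eq_bigr => v /negPf ->.
rewrite raise_lower mulrDr lower_clique // andbC lower_clique //.
rewrite /dirac !entD !ent_adj !ent_boundary prednK // !rmorphM !rmorph_nat /= !lower_real.
by rewrite !natrD; ring.
Qed.

End DiracEntries.

(** * Characterising cliques by counting edges or missing edges *)

Section PairCounts.
Variable n : nat.
Implicit Types (f e : rel 'I_n) (x : basis 'I_n) (u v : 'I_n).

Lemma mem_edges f u v : symmetric f -> ([set u; v] \in edges f) = f u v.
Proof.
move=> fsym; apply/imset2P/idP => [[u' v' _ h /setP uv']|fuv]; last by exists u v.
have {h} fuv' : f u' v' := h.
have := uv' u; have := uv' v; have := uv' u'; have := uv' v'; rewrite !inE !eqxx ?orbT /=.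
move=> /pred2P + /pred2P + /esym/pred2P + /esym/pred2P.
by do 4![case=> ?]; subst => //; rewrite fsym.
Qed.

Lemma edges_pair f p : p \in edges f -> exists u v, p = [set u; v].
Proof. by case/imset2P => u v _ _ ->; exists u, v. Qed.

Lemma edges_card f p : irreflexive f -> p \in edges f -> #|p| = 2.
Proof.
move=> firr /imset2P [u v _ h ->]; have {h} fuv : f u v := h.
by rewrite cards2; case: eqP fuv => // ->; rewrite firr.
Qed.

Lemma inside_card (A : {set {set 'I_n}}) x :
  inside A x = #|[set p in A | p \subset vertices x]|.
Proof.
rewrite /inside cardE size_filter count_filter.
by apply: eq_count => p; rewrite /= !inE andbC.
Qed.

(** The edges inside [x] form a subset of its 'C(j, 2) pairs of vertices; equal cardinality means
    that every pair is an edge. *)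
Lemma clique_edges e j x : symmetric e -> irreflexive e ->
  is_clique e j x = (#|vertices x| == j) && (inside (edges e) x == 'C(j, 2)).
Proof.
move=> esym eirr; rewrite /is_clique; case: eqP => //= <-.
rewrite inside_card -cards_draws.
have sub : [set p in edges e | p \subset vertices x]
    \subset [set p : {set 'I_n} | p \subset vertices x & #|p| == 2].
  apply/subsetP => p; rewrite !inE => /andP [pe ->].
  by rewrite (edges_card eirr pe).
rewrite (subset_leqif_cards sub); apply/forall_inP/eqP => [h|h u ux].
  apply/eqP; rewrite eqEsubset sub /=; apply/subsetP => p; rewrite !inE.
  case/andP=> px /cards2P [u [v [uv ep]]]; rewrite px andbT ep mem_edges //.
  move: px; rewrite ep subUset !sub1set => /andP [ux vx].
  by have /forall_inP /(_ v vx) /implyP := h u ux; apply.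
apply/forall_inP => v vx; apply/implyP => uv.
have : [set u; v] \in [set p : {set 'I_n} | p \subset vertices x & #|p| == 2].
  by rewrite inE subUset !sub1set ux vx cards2 uv.
by rewrite -h inE mem_edges // => /andP [].
Qed.

Lemma clique_missing e j x : symmetric e ->
  is_clique e j x = (#|vertices x| == j) && (inside (missing_edges e) x == 0).
Proof.
move=> esym; rewrite /is_clique; case: eqP => //= _.
have msym : symmetric (fun u v => (u != v) && ~~ e u v).
  by move=> u v; rewrite eq_sym esym.
rewrite inside_card cards_eq0; apply/forall_inP/eqP => [h|/setP h u ux].
  apply/setP => p; rewrite !inE; apply/negbTE/negP => /andP [pe].
  have [u [v ep]] := edges_pair pe; move: pe; rewrite ep mem_edges // => /andP [uv nuv].
  rewrite subUset !sub1set => /andP [ux vx].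
  by have /forall_inP /(_ v vx) /implyP /(_ uv) := h u ux; apply/negP.
apply/forall_inP => v vx; apply/implyP => uv; apply: contraT => nuv.
have := h [set u; v]; rewrite !inE mem_edges // uv nuv subUset !sub1set ux vx.
by [].
Qed.

End PairCounts.

(** * Assembling the block encoding *)

Section Assembly.
Variables (C : numClosedFieldType) (m b n : nat).
Local Notation a := (m + b).+1.
Local Notation Q := ('I_a + 'I_n)%type.

(** The ancillas are m index qubits, then b padding qubits, and finally the flag. *)
Definition reg (i : 'I_(m + b)) : Q := inl (widen_ord (leqnSn _) i).
Definition regs : seq Q := [seq reg i | i <- enum 'I_(m + b)].
Definition flagq : Q := inl ord_max.

Lemma size_regs : size regs = (m + b)%N.
Proof. by rewrite size_map size_enum_ord. Qed.

Lemma reg_inj : injective reg.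
Proof. by move=> i j [] ij; apply/val_inj. Qed.

Lemma uniq_regs : uniq (flagq :: take m regs ++ drop m regs).
Proof.
rewrite cat_take_drop /= map_inj_uniq ?enum_uniq ?andbT; last exact: reg_inj.
by apply/mapP => -[i _ [] /eqP]; rewrite gtn_eqF.
Qed.

Lemma data_regs (v : 'I_n) : inr v \notin flagq :: take m regs ++ drop m regs.
Proof. by rewrite cat_take_drop inE negb_or /=; apply/mapP => -[]. Qed.

(** The cost is 2 n + 12 (m + b) + 6 for V plus 2 (n + 2 |B| + (m + b + 1) + 9 m + 10) for R. The
    inverse of [lam] is the coefficient t amp1^2 of [ent_lcu]. *)
Lemma block_encoding (e : rel 'I_n) (k t : nat) (B : {set {set 'I_n}}) (T : nat -> nat) :
  (n <= 2 ^ m)%N -> (t <= 2 ^ b)%N -> (0 < k)%N ->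
  (forall p, p \in B -> exists u v, p = [set u; v]) ->
  (forall j x, is_clique e j x = (#|vertices x| == j) && (inside B x == T j)) ->
  exists d : encoding n,
    (cost d <= 4 * n + 4 * #|B| + 32 * m + 14 * b + 28)%N /\
    forall lam : C, lam^-1 = t%:R * (2 ^ (m + b))%:R^-1 *
        (3 - 4 * (n * t)%:R / (2 ^ (m + b))%:R) ^+ 2 ->
      block_encodes e k lam d.
Proof.
move=> nm tb k0 hB hT; pose N := (m + b)%N.
have s1 : size (take m regs) = m by rewrite size_takel // size_regs leq_addr.
have s2 : size (drop m regs) = b by rewrite size_drop size_regs addKn.
have sM : size (take m regs ++ drop m regs) = N by rewrite cat_take_drop size_regs.
have [|||gl [tofV iV]] := @lcu_impl C _ n _ _ _ t uniq_regs data_regs _ _ (n + 2 * N + 1)%N.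
- by rewrite s1.
- by rewrite s2.
- by rewrite sM.
have [w [cR [tofR iR]]] := reflection_circuit C a nm k0 hB hT.
exists (@Encoding n a (n + 2 * N + 1)%N.+3 w (circuit_of gl) cR); split.
  rewrite /cost /= toffoli_circuit_of; move: tofV; rewrite sM /N => tofV.
  by apply: leq_trans (leq_add tofV tofR) _; move: #|B| => c; lia.
move=> lam hlam; exists (lcu C (take m regs) (drop m regs) flagq t); split=> //=.
- exact: impl_unitary iV.
- apply: ent_inj => y x; rewrite ent_flagged entZ ent_dirac // /near_clique.
  have entP z' z : ent (flagged a (clique_proj C e k)) z' z
      = ((lpart z == zero_state _) && near_clique e k (rpart z))%:R * (z' == z)%:R.
    rewrite ent_flagged ent_clique_proj part_eq -mulnb natrM.
    case: (lpart z =P _) => [->|_]; last by rewrite !(mulr0, mul0r).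
    by case: (lpart z' == _); rewrite !(mulr0, mul0r, mul1r, mulr1).
  have -> : ent (flagged a (clique_proj C e k) *m lcu C (take m regs) (drop m regs) flagq t
        *m flagged a (clique_proj C e k)) y x
      = ((lpart y == zero_state _) && near_clique e k (rpart y))%:R
        * ((lpart x == zero_state _) && near_clique e k (rpart x))%:R
        * ent (lcu C (take m regs) (drop m regs) flagq t) y x.
    rewrite ent_mul (bigD1 x) //= big1 => [|z zx]; last by rewrite entP (negPf zx) !mulr0.
    rewrite ent_mul (bigD1 y) //= big1 => [|z zy]; last first.
      by rewrite entP [y == z]eq_sym (negPf zy) mulr0 mul0r.
    by rewrite !entP !eqxx !mulr1 !addr0 mulrAC.
  case: (lpart y =P _) => [y0|_]; last by rewrite /= !mul0r.
  case: (lpart x =P _) => [x0|_]; last by rewrite /= !(mul0r, mulr0).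
  have zero_at z : lpart z = zero_state 'I_a -> forall q, ~~ z (inl q).
    by move=> /ffunP z0 q; have := z0 q; rewrite !ffunE => ->.
  rewrite (ent_lcu C uniq_regs data_regs) ?s1 ?s2 //; try exact: zero_at.
  rewrite hlam /= !mul1r -mulnb natrM -!/(near_clique _ _ _).
  have -> : \sum_v sgn C v x * (y == flip v x)%:R = \sum_v (-1) ^+ before v (rpart x)
      * (rpart y == set_bit (rpart x) v (~~ rpart x v))%:R.
    apply: eq_bigr => v _; congr (_ * _).
      (* Only ones of [x] before [v] contribute a factor -1, which gives the exponent [before v]. *)
      rewrite /sgn (bigID (fun u => rpart x u)) /= [X in _ * X]big1 ?mulr1; last first.
        by move=> u /andP [_ /negPf]; rewrite ffunE => ->.
      rewrite (eq_bigr (fun=> -1)) => [|u /andP [_]]; last by rewrite ffunE => ->.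
      rewrite prodr_const; congr (_ ^+ _); apply: eq_card => u.
      by rewrite !inE unfold_in /= andbC.
    congr (_%:R); congr nat_of_bool; rewrite part_eq.
    have -> : lpart (flip v x) = lpart x by apply/ffunP => q; rewrite !ffunE.
    have -> : rpart (flip v x) = set_bit (rpart x) v (~~ rpart x v).
      by apply/ffunP => u; rewrite !ffunE.
    by rewrite y0 x0 eqxx.
  move: (\sum_v _) => S.
  have -> : amp1 C (take m regs) (drop m regs) t * amp1 C (take m regs) (drop m regs) t
      = (2 ^ N)%:R^-1 * (3 - 4 * (n * t)%:R / (2 ^ N)%:R) ^+ 2.
    rewrite /amp1 hnorm_sqr sM.
    have N0 : (2 ^ N)%:R != 0 :> C by rewrite pnatr_eq0 expn_eq0.
    rewrite mulrACA hnorm_sqr sM; congr (_ * _).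
    by move: ((2 ^ N)%:R : C) N0 ((n * t)%:R : C) => c c0 s; field.
  rewrite !natrM /N; ring.
- by move=> K; rewrite kraus_circuit_of inE => /eqP ->; exists 1; rewrite scale1r.
Qed.

End Assembly.

(** * Numerical estimates and the choice of circuits *)

(** Absorbs the logarithmic cost into one more n: 64 m <= 2^m + 512, and 2^m is below 2 n for m =
    [up_log 2 n] unless n = 1. *)
Lemma up_log_le n : (0 < n)%N -> (32 * up_log 2 n <= n + 256)%N.
Proof.
move=> n0; have pow m : (64 * m <= 2 ^ m + 512)%N.
  elim: m => // m IH; have [m8|m8] := leqP m 7; first by lia.
  have h : (64 <= 2 ^ m)%N.
    by apply: (@leq_trans (2 ^ 6)%N) => //; rewrite leq_exp2l // (leq_trans _ m8).
  by rewrite expnS; lia.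
have := pow (up_log 2 n); case: n n0 => [//|[|n]] _; first by rewrite up_log1.
have := up_log_bounds (isT : 1 < 2)%N (isT : 1 < n.+2)%N => /andP [+ _].
by case: (up_log 2 n.+2) => [|p] /=; rewrite ?expnS; lia.
Qed.

(* With alpha = n t / 2^(m + b) = sin^2 theta, the amplified weight of the good
   states is sin^2 (3 theta) = alpha (3 - 4 alpha)^2; the integer t brings alpha
   so close to 1/4 that this is almost 1. *)
Lemma amplification_parameters (R : realType) (eps : R) : 0 < eps ->
  exists b : nat, forall n m : nat, (0 < n)%N -> (n <= 2 ^ m)%N -> (2 ^ m <= 2 * n)%N ->
    exists (t : nat) (lam : R), [/\ (t <= 2 ^ b)%N, 0 < lam, `|lam - n%:R| <= eps * n%:R &
      lam^-1 = t%:R * (2 ^ (m + b))%:R^-1 * (3 - 4 * (n * t)%:R / (2 ^ (m + b))%:R) ^+ 2].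
Proof.
move=> eps0; have [b0 hb0] : exists b0 : nat, 4 < eps * b0%:R.
  exists (Num.bound (4 / eps)); rewrite mulrC -ltr_pdivrMr //.
  by apply: archi_boundP; rewrite divr_ge0 // ltW.
(* Makes 2^b at least 8 (b0 + 1), so that eta <= 4 / 2^b gives both eta <= 1/2 and eta <= eps,
   uniformly in n. *)
pose b := b0.+3; exists b => n m n0 nm mn.
(* Rounding down puts alpha at or just below 1/4: the gap eta = 1 - 4 alpha is nonnegative and below
   4 n / N. *)
pose N := (2 ^ (m + b))%N; pose t := (N %/ (4 * n))%N.
have Nn : (n * 2 ^ b <= N)%N by rewrite /N expnD leq_mul2r nm orbT.
have tN : (4 * n * t <= N)%N by rewrite mulnC leq_trunc_div.
have Nt : (N < 4 * n * t + 4 * n)%N.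
  by rewrite -mulnSr mulnC ltn_ceil // muln_gt0.
have b8 : (8 * b0.+1 <= 2 ^ b)%N.
  by rewrite /b !expnS !mulnA leq_mul2l /= ltn_expl.
exists t.
pose eta : R := 1 - 4 * (n * t)%:R / N%:R.
have N0 : 0 < N%:R :> R by rewrite ltr0n expn_gt0.
have nR : 0 < n%:R :> R by rewrite ltr0n.
have etaN : eta * N%:R = N%:R - 4 * (n * t)%:R.
  by rewrite mulrBl mul1r divfK ?gt_eqF.
have eta_ge0 : 0 <= eta.
  by rewrite -(pmulr_lge0 _ N0) etaN subr_ge0 -natrM ler_nat mulnA.
have eta_b : eta * (2 ^ b)%:R <= 4.
  have h1 : eta * N%:R <= 4 * n%:R.
    rewrite etaN lerBlDl -!natrM -natrD ler_nat mulnA; exact: ltnW.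
  rewrite -(ler_pM2r nR) -mulrA -natrM mulnC; apply: le_trans h1.
  by rewrite ler_wpM2l // ler_nat.
have eta_half : eta <= 2^-1.
  have h : eta * 8 <= eta * (2 ^ b)%:R.
    by rewrite ler_wpM2l // ler_nat (leq_trans _ b8) // leq_pmulr.
  lra.
have eta_eps : eta <= eps.
  have h : eta * b0%:R <= 4.
    apply: le_trans eta_b; rewrite ler_wpM2l // ler_nat (leq_trans _ b8) //; lia.
  have b00 : 0 < b0%:R :> R by rewrite -(pmulr_rgt0 _ eps0) (lt_trans _ hb0).
  by rewrite -(ler_pM2r b00) (le_trans h) // ltW.
(* This is alpha (3 - 4 alpha)^2 in terms of eta, that is, n / [lam]. Expanding gives 1 - q = eta^2
   (3 + eta) / 4, of second order in eta. *)
pose q : R := (1 - eta) * (2 + eta) ^+ 2 / 4.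
have q0 : 0 < q by rewrite /q; nra.
have qE : q = n%:R * (t%:R * N%:R^-1 * (3 - 4 * (n * t)%:R / N%:R) ^+ 2).
  rewrite /q (_ : 1 - eta = 4 * (n * t)%:R / N%:R); last by rewrite /eta; lra.
  rewrite (_ : 2 + eta = 3 - 4 * (n * t)%:R / N%:R); last by rewrite /eta; lra.
  by rewrite natrM; field; rewrite gt_eqF.
have q1 : q <= 1 by rewrite /q; nra.
have q2 : 1 - q <= eta * q by rewrite /q; nra.
exists (n%:R / q); split.
(* 4 n t <= N = 2^m 2^b <= 2 n 2^b. *)
- rewrite -(@leq_pmul2l (4 * n)) ?muln_gt0 //; apply: leq_trans tN _.
  by rewrite /N expnD leq_mul2r; lia.
- by rewrite divr_gt0.
- have -> : n%:R / q - n%:R = n%:R * ((1 - q) / q).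
    by field; rewrite gt_eqF.
  rewrite ger0_norm; last first.
    by apply: mulr_ge0 (ltW nR) _; rewrite divr_ge0 ?subr_ge0 // ltW.
  rewrite mulrC; apply: (ler_wpM2r (ltW nR)); rewrite ler_pdivrMr //.
  by apply: le_trans q2 _; apply: ler_wpM2r => //; apply: ltW.
- by rewrite invf_div qE mulrAC divff ?mul1r ?gt_eqF //.
Qed.

(* The database determines the graph, so the circuits may be chosen graph by graph. *)
Lemma choose_circuits (db : forall n, rel 'I_n -> {set {set 'I_n}})
    (good : forall n, nat -> rel 'I_n -> encoding n -> Prop) :
  (forall n (e e' : rel 'I_n), symmetric e -> irreflexive e -> symmetric e' -> irreflexive e' ->
     db n e = db n e' -> e = e') ->
  (forall n k (e : rel 'I_n), (0 < n)%N -> (0 < k)%N -> symmetric e -> irreflexive e ->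
     exists d, good n k e d) ->
  exists f : forall n : nat, nat -> seq {set 'I_n} -> encoding n,
    forall n k (e : rel 'I_n) s, (0 < n)%N -> (0 < k)%N -> symmetric e -> irreflexive e ->
      is_database (db n e) s -> good n k e (f n k s).
Proof.
move=> db_inj hgood.
have ex n k (s : seq {set 'I_n}) : exists d : encoding n, forall e : rel 'I_n,
    (0 < n)%N -> (0 < k)%N -> symmetric e -> irreflexive e ->
    is_database (db n e) s -> good n k e d.
  (* A list that is no database of a graph gets the empty encoding; otherwise the graph is unique
     and its encoding serves every admissible [e]. *)
  have [[e [n0 k0 es ei dbe]]|no] := pselect (exists e : rel 'I_n,
      [/\ (0 < n)%N, (0 < k)%N, symmetric e, irreflexive e & is_database (db n e) s]).
    have [d gd] := hgood n k e n0 k0 es ei; exists d => e' _ _ es' ei' dbe'.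
    suff -> : e' = e by [].
    apply: db_inj => //; apply/setP => p.
    by rewrite -!(mem_enum (db n _)) -(perm_mem dbe) (perm_mem dbe').
  by exists (@Encoding n 0 0 0 Stop Stop) => e *; case: no; exists e.
exists (fun n k s => sval (cid (ex n k s))) => n k e s.
by case: (cid _) => d /= hd; apply: hd.
Qed.

Lemma edges_inj n (e e' : rel 'I_n) : symmetric e -> symmetric e' -> edges e = edges e' -> e = e'.
Proof.
move=> es es' /setP ee'; apply/funext => u; apply/funext => v.
by rewrite -(mem_edges u v es) ee' mem_edges.
Qed.

Lemma missing_edges_inj n (e e' : rel 'I_n) : symmetric e -> irreflexive e ->
  symmetric e' -> irreflexive e' -> missing_edges e = missing_edges e' -> e = e'.
Proof.
move=> es ei es' ei' ee'.
have msym (g : rel 'I_n) : symmetric g -> symmetric (fun u v => (u != v) && ~~ g u v).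
  by move=> gs u v; rewrite eq_sym gs.
have /funeqP h := edges_inj (msym _ es) (msym _ es') ee'.
apply/funext => u; apply/funext => v; have /funeqP /(_ v) := h u.
by have [->|_] := eqVneq u v; [rewrite ei ei' | move=> /negb_inj].
Qed.

(** [b] depends on [eps] alone, so 14 b is part of the constant; with m = [up_log 2 n] the term 32 m
    is at most n + 256, whence 5 n and K = 14 b + 284. *)
Lemma bounded_encoding (R : realType) (eps : R) : 0 < eps ->
  exists K : nat, forall n k (e : rel 'I_n) (B : {set {set 'I_n}}) (T : nat -> nat),
    (0 < n)%N -> (0 < k)%N -> (forall p, p \in B -> exists u v, p = [set u; v]) ->
    (forall j x, is_clique e j x = (#|vertices x| == j) && (inside B x == T j)) ->
    exists d : encoding n, (cost d <= 4 * #|B| + 5 * n + K)%N /\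
      exists lam : R, [/\ 0 < lam, `|lam - n%:R| <= eps * n%:R &
        block_encodes e k (real_complex R lam) d].
Proof.
move=> eps0; have [b hb] := amplification_parameters eps0.
exists (14 * b + 284)%N => n k e B T n0 k0 hB hT; pose m := up_log 2 n.
have nm : (n <= 2 ^ m)%N by apply: up_logP.
have mn : (2 ^ m <= 2 * n)%N.
  rewrite /m; case: (n) n0 => [//|[|c]] _; first by rewrite up_log1.
  have := up_log_bounds (isT : 1 < 2)%N (isT : 1 < c.+2)%N => /andP [+ _].
  by case: (up_log 2 c.+2) => [|p] /= h; rewrite ?expnS; lia.
have [t [lam [tb lam0 hlam lamV]]] := hb n m n0 nm mn.
have [d [cd hd]] := block_encoding R[i] nm tb k0 hB hT.
exists d; split.
  apply: leq_trans cd _; have := up_log_le n0; rewrite -/m; move: #|B| => c; lia.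
exists lam; split=> //; apply: hd; rewrite -fmorphV lamV.
by rewrite !(rmorphM, rmorphXn, rmorphB, fmorphV, rmorph_nat).
Qed.

Local Open Scope complex_scope.

Theorem lemma5 (R : realType) (eps : R) (eps_gt0 : 0 < eps) :
  exists (K : R)
    (from_edges from_missing :
       forall n : nat, nat -> seq {set 'I_n} -> encoding n),
    forall (n k : nat) (e : rel 'I_n) (s : seq {set 'I_n}),
      (0 < n)%N -> (0 < k)%N -> symmetric e -> irreflexive e ->
      (is_database (edges e) s ->
         exists lam : R,
           [/\ 0 < lam, `|lam - n%:R| <= eps * n%:R,
               block_encodes e k (lam%:C : R[i]) (from_edges n k s) &
               (cost (from_edges n k s))%:R
               <= 6 * #|edges e|%:R + 2 * log2 (k%:R : R) + 5 * n%:R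
                  + 11 * log2 (n%:R : R) + K]) /\
      (is_database (missing_edges e) s ->
         exists lam : R,
           [/\ 0 < lam, `|lam - n%:R| <= eps * n%:R,
               block_encodes e k (lam%:C : R[i]) (from_missing n k s) &
               (cost (from_missing n k s))%:R
               <= 4 * #|missing_edges e|%:R + 5 * n%:R
                  + 11 * log2 (n%:R : R) + K]).
Proof.
have [K hK] := bounded_encoding eps_gt0.
have log2_ge0 j : (0 < j)%N -> 0 <= log2 (j%:R : R).
  by move=> j0; rewrite divr_ge0 // ln_ge0 // ler1n.
pose good n (B : {set {set 'I_n}}) k (e : rel 'I_n) (d : encoding n) :=
  (cost d <= 4 * #|B| + 5 * n + K)%N /\
  exists lam : R, [/\ 0 < lam, `|lam - n%:R| <= eps * n%:R & block_encodes e k lam%:C d].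
have [|n k e n0 k0 es ei|from_edges hE] := @choose_circuits (fun n => @edges n)
    (fun n k e d => good n (edges e) k e d).
- by move=> n e e' es _ es' _; apply: edges_inj.
- by apply: (hK n k e (edges e) (fun j => 'C(j, 2))) => // [p /edges_pair|j x] //; apply: clique_edges.
have [|n k e n0 k0 es ei|from_missing hM] := @choose_circuits (fun n => @missing_edges n)
    (fun n k e d => good n (missing_edges e) k e d).
- by move=> n e e' es ei es' ei'; apply: missing_edges_inj.
- by apply: (hK n k e (missing_edges e) (fun=> 0%N)) => // [p /edges_pair|j x] //; apply: clique_missing.
exists K%:R, from_edges, from_missing => n k e s n0 k0 es ei; split=> db.
  have [cd [lam [lam0 lamn enc]]] := hE n k e s n0 k0 es ei db.
  exists lam; split=> //; move: cd; rewrite -(ler_nat R) (natrD _ (_ + _) K) (natrD _ (4 * _)) !natrM.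
  (* The circuits cost at most 4 |E| + 5 n + K, and the remaining terms of the bound are
     nonnegative. *)
  have := log2_ge0 n n0; have := log2_ge0 k k0; have : 0 <= #|edges e|%:R :> R by [].
  by lra.
have [cd [lam [lam0 lamn enc]]] := hM n k e s n0 k0 es ei db.
exists lam; split=> //; move: cd; rewrite -(ler_nat R) (natrD _ (_ + _) K) (natrD _ (4 * _)) !natrM.
by have := log2_ge0 n n0; lra.
Qed.
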